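(* For any numbers $c$ with $0<c<1/2$, $N\ge 20$, and $K$ with \[ 1<K\le\exp\left(c\,\frac{\log N\,\log\log\log N}{\log\log N}\right), \] if $S$ is a set of (distinct) integers contained in $(N,KN]$, then \[ \delta^-(S)=(1+o(1))\,\alpha(S)\qquad\text{as } N\to\infty, \] where the function ''$o(1)$'' depends only on the choice of $c$. That is, for each $c\in(0,1/2)$ there is a function $\eta_c:[20,\infty)\to[0,\infty)$ with $\eta_c(N)\to0$ as $N\to\infty$ such that $|\delta^-(S)-\alpha(S)|\le \eta_c(N)\,\alpha(S)$ for all $N\ge 20$, all $K$ with $1<K\le\exp\left(c\,\frac{\log N\,\log\log\log N}{\log\log N}\right)$, and all sets $S$ of (distinct) integers contained in $(N,KN]$.
   Context: $N$, $K$ and $c$ are real numbers. For a finite set $S$ of positive integers and a choice of an integer $r(n)$ for each $n\in S$, consider the set of integers that are not in the union of the residue classes $r(n)\pmod n$, $n\in S$. This set is a union of residue classes modulo $\mathrm{lcm}(S)$ and so has an asymptotic density. $\delta^-(S)$ denotes the minimum of this density over all choices of the integers $r(n)$, $n\in S$ (one residue class for each modulus $n\in S$). Also \[ \alpha(S)=\prod_{n\in S}\left(1-\frac1n\right). \] *)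

(* Defs.v *)
From HB Require Import structures.
From mathcomp Require Import all_boot all_order all_algebra finmap.
From mathcomp Require Import all_classical all_reals all_analysis.

Set Implicit Arguments.
Unset Strict Implicit.
Unset Printing Implicit Defensive.

Import Order.TTheory GRing.Theory Num.Theory numFieldNormedType.Exports.

Local Open Scope classical_set_scope.
Local Open Scope ring_scope.

Definition count_from (A : pred int) (a : int) (n : nat) : nat :=
  \sum_(i < n) A (a + i%:Z)%R.

(* Proportion of elements of [A] among the 2m+1 integers k with |k| <= m. *)
Definition proportion (R : realType) (A : pred int) (m : nat) : R :=
  (count_from A (- m%:Z) m.*2.+1)%:R / m.*2.+1%:R.

(* [lim] is a junk value for sets without asymptotic density; see
   [cvg_density_uncovered] for the sets at hand. *)
Definition density (R : realType) (A : pred int) : R :=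
  lim (proportion R A m @[m --> \oo]).

(* [r] is total, but only its values on [S] matter. *)
Definition uncovered (S : {fset nat}) (r : nat -> int) : pred int :=
  fun k => all (fun n => ~~ (k == r n %[mod n%:Z])%Z) S.

(* The infimum is a minimum: see [delta_minus_min]. *)
Definition delta_minus (R : realType) (S : {fset nat}) : R :=
  inf [set density R (uncovered S r) | r in [set: nat -> int]].

Definition alpha (R : realType) (S : {fset nat}) : R :=
  \prod_(n <- S) (1 - n%:R^-1).

Section Periodic.
Variables (A : pred int) (L : nat).
Hypotheses (L_gt0 : (0 < L)%N) (periodicA : forall k, A (k + L%:Z) = A k).

Lemma count_fromD a m n :
  count_from A a (m + n) = (count_from A a m + count_from A (a + m%:Z) n)%N.
Proof.
rewrite /count_from big_split_ord /=; congr addn.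
by apply: eq_bigr => i _; rewrite PoszD addrA.
Qed.

Lemma count_from_le a n : (count_from A a n <= n)%N.
Proof.
rewrite -[leqRHS]card_ord -sum1_card; apply: leq_sum => i _.
exact: leq_b1.
Qed.

Lemma count_from_succ a : count_from A (a + 1) L = count_from A a L.
Proof.
have := count_fromD a 1 L; rewrite addnC count_fromD.
rewrite {2 3}/count_from !big_ord1 /= !addr0 periodicA addnC.
by move/addnI.
Qed.

Lemma count_from_period a : count_from A a L = count_from A 0 L.
Proof.
have nonneg (b : int) (n : nat) : count_from A (b + n%:Z) L = count_from A b L.
  elim: n => [|n IHn]; first by rewrite addr0.
  by rewrite -addn1 PoszD addrA count_from_succ.
case: (intP a) => [//|n|n]; first by rewrite -[n.+1%:Z]add0r nonneg.
by rewrite -(nonneg (- n.+1%:Z) n.+1) addNr.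
Qed.

Lemma count_from_mul a q : count_from A a (q * L) = (q * count_from A 0 L)%N.
Proof.
elim: q a => [|q IHq] a; first by rewrite /count_from mul0n big_ord0.
by rewrite !mulSn count_fromD count_from_period IHq.
Qed.

Lemma cvg_proportion_periodic (R : realType) :
  proportion R A m @[m --> \oo] --> ((count_from A 0 L)%:R / L%:R : R).
Proof.
have bound m : `|proportion R A m - (count_from A 0 L)%:R / L%:R|
               <= L%:R / m.+1%:R :> R.
  rewrite /proportion; set n := m.*2.+1; set a := - m%:Z.
  have L0 : L%:R != 0 :> R by rewrite pnatr_eq0 -lt0n.
  have n0 : n%:R != 0 :> R by rewrite pnatr_eq0.
  set C := count_from A 0 L; set t := (n %% L)%N; set q := (n %/ L)%N.
  set e := count_from A (a + (q * L)%N%:Z) t.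
  have nE : n = (q * L + t)%N by exact: divn_eq.
  have cE : count_from A a n = (q * C + e)%N.
    by rewrite nE count_fromD count_from_mul.
  have -> : (count_from A a n)%:R / n%:R - C%:R / L%:R
          = (e%:R * L%:R - C%:R * t%:R) / (n%:R * L%:R) :> R.
    rewrite -mulNr addf_div // cE; congr (_ / _).
    rewrite [in - C%:R * _]nE !natrD !natrM !mulrDl !mulrDr !mulNr.
    rewrite addrACA -mulrA [C%:R * L%:R]mulrC mulrA.
    by rewrite -[q%:R * L%:R * C%:R]mulrC subrr add0r.
  have tL : (t <= L)%N by rewrite ltnW// ltn_pmod.
  have eL : (e <= L)%N by apply: leq_trans tL; exact: count_from_le.
  have CL : (C <= L)%N by exact: count_from_le.
  rewrite normrM normfV (ger0_norm (_ : 0 <= n%:R * L%:R)) ?mulr_ge0//.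
  rewrite ler_pdivrMr ?mulr_gt0 ?ltr0n//.
  apply: (@le_trans _ _ (L%:R * L%:R)).
    rewrite ler_norml; apply/andP; split.
      rewrite lerBrDr addrC lerBlDr (le_trans (_ : _ <= L%:R * L%:R))//.
        by rewrite -!natrM ler_nat leq_mul.
      by rewrite lerDr -natrM.
    rewrite lerBlDr (le_trans (_ : _ <= L%:R * L%:R))//.
      by rewrite -!natrM ler_nat leq_mul.
    by rewrite lerDl -natrM.
  rewrite mulrA ler_wpM2r// -mulrA ler_peMr// mulrC ler_pdivlMr ?ltr0n//.
  by rewrite mul1r ler_nat ltnS -addnn leq_addr.
apply/cvgrPdist_le => eps eps0.
have : L%:R * (m.+1%:R^-1 : R) @[m --> \oo] --> (0 : R).
  rewrite -(mulr0 L%:R); apply: cvgMr; exact: cvg_harmonic.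
move=> /cvgrPdist_le /(_ _ eps0); apply: filterS => m /=.
rewrite sub0r normrN => Hm; rewrite distrC.
exact: le_trans (bound m) (le_trans (ler_norm _) Hm).
Qed.

End Periodic.

Section Uncovered.
Variables (R : realType) (S : {fset nat}).
Hypothesis S_gt0 : forall n, n \in S -> (0 < n)%N.

Let L := (\prod_(n <- S) n)%N.

Let L_gt0 : (0 < L)%N.
Proof. by rewrite /L big_seq; apply: prodn_cond_gt0. Qed.

Let periodic_uncovered r k : uncovered S r (k + L%:Z) = uncovered S r k.
Proof.
apply: eq_in_all => n nS; congr (~~ _).
rewrite /L (big_rem n)//= PoszM.
by rewrite mulrC -modzDmr modzMl addr0.
Qed.

Let density_uncoveredE r :
  density R (uncovered S r) = (count_from (uncovered S r) 0 L)%:R / L%:R.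
Proof.
apply/cvg_lim => //; exact: cvg_proportion_periodic.
Qed.

Lemma cvg_density_uncovered r :
  proportion R (uncovered S r) m @[m --> \oo] --> density R (uncovered S r).
Proof.
rewrite density_uncoveredE; exact: cvg_proportion_periodic.
Qed.

Lemma delta_minus_min :
  exists2 r, density R (uncovered S r) = delta_minus R S &
  forall r', delta_minus R S <= density R (uncovered S r').
Proof.
pose P j := `[< exists r, count_from (uncovered S r) 0 L = j >].
have exP : exists j, P j.
  exists (count_from (uncovered S (fun=> 0)) 0 L).
  by apply/asboolP; exists (fun=> 0).
case: (ex_minnP exP) => j /asboolP[r rj] jmin.
have rmin r' : density R (uncovered S r) <= density R (uncovered S r').
  rewrite !density_uncoveredE ler_wpM2r ?invr_ge0// ler_nat rj.
  by apply: jmin; apply/asboolP; exists r'.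
have rE : delta_minus R S = density R (uncovered S r).
  apply/eqP; rewrite eq_le; apply/andP; split.
    apply: ge_inf; last by exists r.
    by exists (density R (uncovered S r)) => _ [r' _ <-].
  apply: lb_le_inf; first by exists (density R (uncovered S r)), r.
  by move=> _ [r' _ <-].
by exists r => // r'; rewrite rE.
Qed.

End Uncovered.

(* Main.v *)
(* Averaging over the choice of residues gives delta^- <= alpha. For the lower
   bound, write n = n_Q n' with n_Q the Q-smooth part of n, and fix the residue
   h of k modulo a Q-smooth M divisible by every n_Q. Inside the class of h the
   modulus n either drops out or sieves one class modulo n', and n', m'
   interact only if they share a prime q > Q. A truncated sieve gives the
   local density prod (1 - 1/n') - sum 1/(n' m'), and averaging over h, with
   Jensen's inequality for the main term, gives the lower bound
     e^(-A) (1 - eps (1 + A)) - beta,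
   where A is close to sum 1/n, eps = sum 1/n over the Q-smooth n in S, and
   beta is the sum over pairs with gcd(n', m') > 1 of gcd(n_Q, m_Q)/(n m),
   which is at most (1 + log(KN))^3/Q. As alpha >= 1/(2K), beta is negligible
   once Q exceeds K by a power of log N. With log Q close to
   c' log N logloglog N/loglog N for some c < c' < 1/2, we have N >= Q^k with
   k ~ loglog N/(c' logloglog N), and eps is about log N 2^k/k!, that is
   (log N)^(1 - 1/c' + o(1)); it beats A = O(log N) because 1/c' > 2. *)
Require Import Defs.
From HB Require Import structures.
From mathcomp Require Import all_boot all_order all_algebra finmap.
From mathcomp Require Import all_classical all_reals all_analysis.
From mathcomp Require Import zify ring lra.

Set Implicit Arguments.
Unset Strict Implicit.
Unset Printing Implicit Defensive.

Import Order.TTheory GRing.Theory Num.Theory numFieldNormedType.Exports.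

Local Open Scope classical_set_scope.
Local Open Scope ring_scope.

(** * Counting in residue classes *)

Definition ints (n : nat) : seq int := [seq i%:Z | i <- iota 0 n].

Definition modeq (n : nat) (a : int) : pred int :=
  fun k => (k == a %[mod n%:Z])%Z.

(** [uncovered S r] unfolds to [avoids S r]; the version for sequences allows passing to some of the
    moduli only. *)
Definition avoids (s : seq nat) (r : nat -> int) : pred int :=
  fun k => all (fun n => ~~ modeq n (r n) k) s.

Lemma size_ints n : size (ints n) = n.
Proof. by rewrite size_map size_iota. Qed.

Lemma count_intsE (A : pred int) n : count A (ints n) = count_from A 0 n.
Proof.
rewrite /count_from -(big_mkord xpredT (fun i => A (0 + i%:Z) : nat)).
rewrite -sumn_count sumnE !big_map /index_iota subn0.
by apply: eq_bigr => i _; rewrite add0r.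
Qed.

Lemma periodic_dvd (T : Type) (A : int -> T) L P : (L %| P)%N ->
  (forall k, A (k + L%:Z) = A k) -> forall k, A (k + P%:Z) = A k.
Proof.
move=> /dvdnP[q ->] pA k; elim: q => [|q IHq]; first by rewrite mul0n addr0.
by rewrite mulSn addnC PoszD addrA pA.
Qed.

Lemma modeq_periodic n a k : modeq n a (k + n%:Z) = modeq n a k.
Proof. by rewrite /modeq modzDr. Qed.

Lemma avoids_periodic s r P : (forall n, n \in s -> (n %| P)%N) ->
  forall k, avoids s r (k + P%:Z) = avoids s r k.
Proof.
move=> sP k; apply: eq_in_all => n ns; congr (~~ _).
exact: (periodic_dvd (sP n ns) (modeq_periodic n (r n))).
Qed.

Lemma modeq_shift n a b k : modeq n (a + b) (k + b) = modeq n a k.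
Proof. by rewrite /modeq eqz_modDr. Qed.

Lemma count_shift (A : pred int) P (a : nat) : (0 < P)%N ->
  (forall k, A (k + P%:Z) = A k) ->
  count (fun k => A (k + a%:Z)) (ints P) = count A (ints P).
Proof.
move=> P0 pA; rewrite !count_intsE -(count_from_period pA a).
by apply: eq_bigr => i _; rewrite add0r addrC.
Qed.

Lemma count_sum_class (A : pred int) n (W : seq int) : (0 < n)%N ->
  (\sum_(i < n) count (fun k => A k && modeq n i k) W = count A W)%N.
Proof.
move=> n0; elim: W => [|k W IHW] /=; first by rewrite big1.
rewrite big_split /= IHW; congr addn.
case: (A k) => /=; last by rewrite big1.
have kn : (`|(k %% n)%Z| < n)%N.
  by rewrite -ltz_nat gez0_abs ?ltz_pmod// modz_ge0// -lt0n.
rewrite (bigD1 (Ordinal kn)) //= big1 ?addn0.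
  by rewrite /modeq gez0_abs ?modz_mod ?eqxx ?modz_ge0// -lt0n.
move=> i; rewrite -val_eqE /= => ni; apply/eqP; rewrite eqb0; apply: contraNN ni.
rewrite /modeq => /eqP ->; rewrite modz_small ?ltz_nat ?ltn_ord//.
Qed.

(** Translation by multiples of [L] preserves [A] and, since [L] is invertible modulo [n], carries
    any class modulo [n] to any other. So the [n] classes share the points of [A] in a common period
    [P] equally. *)
Lemma count_equidistributed (A : pred int) L n P (r : int) :
  (0 < P)%N -> (L %| P)%N -> (n %| P)%N -> coprime L n ->
  (forall k, A (k + L%:Z) = A k) ->
  (n * count (fun k => A k && modeq n r k) (ints P) = count A (ints P))%N.
Proof.
move=> P0 LP nP cLn pA.
have n0 : (0 < n)%N by rewrite (dvdn_gt0 P0 nP).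
pose c a := count (fun k => A k && modeq n a k) (ints P).
have cP a : forall k, A (k + P%:Z) && modeq n a (k + P%:Z) = A k && modeq n a k.
  by move=> k; rewrite (periodic_dvd LP pA) (periodic_dvd nP (modeq_periodic n a)).
have cL (j : nat) a : c (a + (j * L)%N%:Z) = c a.
  rewrite /c -[LHS](@count_shift _ _ (j * L) P0 (cP _)).
  by apply: eq_count => k; rewrite modeq_shift (periodic_dvd (dvdn_mull j (dvdnn L)) pA).
have cmod a b : (a = b %[mod n])%Z -> c a = c b.
  by move=> ab; apply: eq_count => k; rewrite /modeq ab.
have cE (i : nat) : c i = c r.
  (* The Chinese remainder solution of 0 modulo [L] and 1 modulo [n], scaled by [t], is a multiple
     [j * L] congruent to [i - r] modulo [n]. *)
  pose t := (`|((i%:Z - r) %% n)%Z|)%N.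
  pose j := (t * chinese L n 0 1 %/ L)%N.
  have Ldiv : (L %| chinese L n 0 1)%N.
    by apply/eqP; rewrite (chinese_modl cLn) mod0n.
  have jE : (j * L = t * chinese L n 0 1)%N by rewrite /j divnK // dvdn_mull.
  rewrite -(cL j r); apply: cmod; rewrite jE.
  have ti : (t%:Z = i%:Z - r %[mod n])%Z.
    by rewrite /t gez0_abs ?modz_mod// modz_ge0// -lt0n.
  have tch : ((t * chinese L n 0 1)%N = t%:Z %[mod n])%Z.
    rewrite !modz_nat; congr Posz.
    by rewrite -modnMmr (chinese_modr cLn) modnMmr muln1.
  by rewrite -modzDmr tch ti modzDmr addrC subrK.
rewrite -[RHS](count_sum_class A (ints P) n0).
rewrite (eq_bigr (fun=> c r)) => [|i _]; last exact: cE.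
by rewrite sum_nat_const card_ord.
Qed.

(** * A truncated sieve for partially dependent events, and greedy residues *)

Lemma count_split (T : Type) (A B : pred T) (W : seq T) :
  count A W = (count (fun w => A w && B w) W + count (fun w => A w && ~~ B w) W)%N.
Proof.
elim: W => //= w W ->; rewrite addnACA; congr addn.
by case: (A w); case: (B w).
Qed.

(* Removing the events one by one, the event i is compared with those of its
   predecessors that are independent of it; the others cost p i * p j each. *)
Lemma sieve_lower_bound (R : realDomainType) (T : Type) (I : eqType)
    (W : seq T) (ev : I -> pred T) (p : I -> R) (dep : rel I) (s : seq I) :
  uniq s -> {in s, forall i, 0 <= p i <= 1} ->
  (forall i (t : seq I), i \in s -> {subset t <= s} ->
    (forall j, j \in t -> (j != i) && ~~ dep i j) ->
    (count (fun w => all (fun j => ~~ ev j w) t && ev i w) W)%:R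
      = p i * (count (fun w => all (fun j => ~~ ev j w) t) W)%:R) ->
  (\prod_(i <- s) (1 - p i)
    - \sum_(i <- s) \sum_(j <- s | (j != i) && dep i j) p i * p j)
    * (size W)%:R <= (count (fun w => all (fun j => ~~ ev j w) s) W)%:R.
Proof.
elim: s => [|i s IHs] /=.
  by rewrite !big_nil subr0 mul1r count_predT.
move=> /andP[is_ us] p01 indep.
have p_i : 0 <= p i <= 1 by apply: p01; rewrite mem_head.
have p_s j : j \in s -> 0 <= p j <= 1 by move=> js; apply: p01; rewrite in_cons js orbT.
set none := fun t : seq I => fun w => all (fun j => ~~ ev j w) t.
have {}IHs := IHs us p_s.
have /IHs {}IHs : forall j (t : seq I), j \in s -> {subset t <= s} ->
    (forall j', j' \in t -> (j' != j) && ~~ dep j j') ->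
    (count (fun w => none t w && ev j w) W)%:R = p j * (count (none t) W)%:R.
  move=> j t js ts; apply: indep; first by rewrite in_cons js orbT.
  by move=> x /ts xs; rewrite in_cons xs orbT.
set beta := \sum_(i <- s) _ in IHs.
set pi := \prod_(i <- s) _ in IHs.
set b := \sum_(j <- s | dep i j) p j.
pose t := [seq j <- s | ~~ dep i j].
set Sigma := \sum_(i <- i :: s) _.
(* Row [i] of [Sigma] gives [p i * b], the rows of [s] at least [beta]: their entries in column [i]
   are dropped. *)
have betaE : p i * b + beta <= Sigma.
  rewrite /Sigma big_cons big_cons eqxx /= big_distrr /=; apply: lerD.
    rewrite big_seq_cond [leRHS]big_seq_cond le_eqVlt; apply/orP; left; apply/eqP.
    apply: eq_bigl => j; case js: (j \in s) => //=.
    by case: (eqVneq j i) => // ji; rewrite -ji js in is_.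
  rewrite /beta [leLHS]big_seq [leRHS]big_seq; apply: ler_sum => j js.
  have /andP[pj0 _] := p_s j js; have /andP[pi0 _] := p_i.
  by rewrite big_cons; case: ifP => // _; rewrite lerDr mulr_ge0.
rewrite big_cons -/pi.
have cnt_i : (count (none (i :: s)) W)%:R =
    (count (none s) W)%:R - (count (fun w => none s w && ev i w) W)%:R :> R.
  apply/eqP; rewrite eq_sym subr_eq -natrD; apply/eqP; congr _%:R.
  rewrite (count_split _ (ev i)) addnC; congr addn.
  by apply: eq_count => w /=; rewrite andbC.
(* Forgetting the events dependent on [i] enlarges the count, and independence applies to those kept
   in [t]. *)
have le1 : (count (fun w => none s w && ev i w) W)%:R <= p i * (count (none t) W)%:R :> R.
  rewrite -indep ?mem_head//.
  - rewrite ler_nat; apply: sub_count => w /andP[/allP sw ->]; rewrite andbT.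
    by apply/allP => j; rewrite mem_filter => /andP[_ /sw].
  - by move=> j; rewrite mem_filter in_cons => /andP[_ ->]; rewrite orbT.
  - move=> j; rewrite mem_filter => /andP[-> js]; rewrite andbT.
    by apply: contraNneq is_ => <-.
have ev_j j : j \in s -> (count (ev j) W)%:R = p j * (size W)%:R.
  by move=> js; rewrite (indep j [::]) ?in_cons ?js ?orbT //= count_predT.
(* A point avoiding [t] but not all of [s] lies in some [ev j] with [dep i j]: a union bound. *)
have le2 : (count (none t) W)%:R <= (count (none s) W)%:R + b * (size W)%:R.
  have -> : b * (size W)%:R = (\sum_(j <- s | dep i j) count (ev j) W)%N%:R.
    rewrite natr_sum big_distrl /= big_seq_cond [RHS]big_seq_cond.
    by apply: eq_bigr => j /andP[js _]; rewrite ev_j.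
  rewrite -natrD ler_nat.
  elim: (W) => //= w W' IH; rewrite big_split /= addnACA; apply: leq_add => //.
  have [/allP tw|//] := boolP (none t w).
  have [//|/allPn[j js]] := boolP (none s w); rewrite negbK => jw /=.
  have dj : dep i j.
    by apply: contraLR jw => dj; apply: tw; rewrite mem_filter dj.
  by rewrite (big_rem j) //= dj jw.
case/andP: p_i => pi0 pi1; rewrite cnt_i.
have pib : p i * (count (none t) W)%:R <= p i * ((count (none s) W)%:R + b * (size W)%:R).
  exact: ler_wpM2l.
have := ler_wpM2l (_ : 0 <= 1 - p i) IHs; rewrite subr_ge0 => /(_ pi1) IH1.
have beta0 : 0 <= beta.
  rewrite /beta big_seq sumr_ge0 // => j js; rewrite big_seq_cond sumr_ge0 // => k /andP[ks _].
  by rewrite mulr_ge0//; [case/andP: (p_s j js)|case/andP: (p_s k ks)].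
have W0 : 0 <= (size W)%:R :> R by [].
have le3 : (p i * b + beta) * (size W)%:R <= Sigma * (size W)%:R by rewrite ler_wpM2r.
have le4 : 0 <= p i * (beta * (size W)%:R) by rewrite !mulr_ge0.
have le5 := le_trans le1 pib.
(* Linear in the monomials of the abstracted quantities; the surplus [p i * beta] is discarded
   through [le4]. *)
have key (X Y Z S' B b' q x : R) : (x * b' + B) * Z <= S' * Z -> 0 <= x * (B * Z) ->
    Y <= x * (X + b' * Z) -> (1 - x) * ((q - B) * Z) <= (1 - x) * X ->
    ((1 - x) * q - S') * Z <= X - Y.
  by move=> *; lra.
exact: key le3 le4 le5 IH1.
Qed.

Lemma count_eq_mod (n P : nat) (r : int) : (0 < P)%N -> (n %| P)%N ->
  (n * count (modeq n r) (ints P) = P)%N.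
Proof.
move=> P0 nP; rewrite -[RHS]size_ints -[RHS]count_predT.
by apply: (@count_equidistributed predT 1 n P r) => //; exact: coprime1n.
Qed.

(** Greedy choice: of the points surviving the moduli of [s], some class modulo [n] contains a
    proportion at least [1/n], and removing it costs a factor at most [1 - 1/n]. No structure of [W]
    enters. *)
Lemma exists_residues (R : realFieldType) (s : seq nat) (W : seq int) :
  uniq s -> all (fun n => 0 < n)%N s ->
  exists r, (count (avoids s r) W)%:R <= \prod_(n <- s) (1 - n%:R^-1) * (size W)%:R :> R.
Proof.
elim: s => [|n s IHs] /=.
  by exists (fun=> 0); rewrite big_nil mul1r count_predT.
move=> /andP[ns us] /andP[n0 s0]; have [r Hr] := IHs us s0.
have [a Ha] : exists a : 'I_n, (count (avoids s r) W
    <= n * count (fun k => avoids s r k && modeq n a k) W)%N.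
    case: (@arg_maxnP _ (Ordinal n0) xpredT
      (fun i : 'I_n => count (fun k => avoids s r k && modeq n i k) W)) => // a _ amax.
    exists a; rewrite -(count_sum_class _ W n0) -[X in (_ <= X * _)%N]card_ord.
    by rewrite -sum_nat_const; apply: leq_sum => i _; exact: amax.
  pose r' m := if m == n then a%:Z else r m; exists r'.
  have r's : avoids s r' =1 avoids s r.
    move=> k; apply: eq_in_all => m ms; rewrite /r'; case: eqP => // mn.
    by rewrite -mn ms in ns.
  have -> : (count (fun k => ~~ modeq n (r' n) k && avoids s r' k) W)%:R =
     (count (avoids s r) W)%:R - (count (fun k => avoids s r k && modeq n a k) W)%:R :> R.
    apply/eqP; rewrite eq_sym subr_eq -natrD; apply/eqP; congr _%:R.
    rewrite (count_split _ (modeq n a)) addnC; congr addn; apply: eq_count => k /=.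
    by rewrite /r' eqxx r's andbC.
  rewrite big_cons -mulrA.
  apply: le_trans (ler_wpM2l _ Hr); last first.
    by rewrite subr_ge0 invf_le1 ?ler1n ?ltr0n.
  rewrite mulrBl mul1r lerD2l lerN2 mulrC ler_pdivrMr ?ltr0n//.
  by rewrite -natrM ler_nat mulnC.
Qed.

(** * Sieving by smooth parts *)

Lemma sum_ints (V : nmodType) n (F : int -> V) :
  \sum_(k <- ints n) F k = \sum_(i < n) F i%:Z.
Proof. by rewrite big_map -(big_mkord xpredT (fun i => F i%:Z)) /index_iota subn0. Qed.

Lemma sum_nat_of_bool (R : pzSemiRingType) (T : Type) (W : seq T) (A : pred T) :
  \sum_(k <- W) (A k)%:R = (count A W)%:R :> R.
Proof. by rewrite -natr_sum -sum1_count [in RHS]big_mkcond. Qed.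

Lemma modeq_dvd d n a b k : (d %| n)%N -> modeq n b k -> modeq d a k = modeq d a b.
Proof.
move=> dn; rewrite /modeq (eqz_mod_dvd n k b) => kb; congr (_ == _); apply/eqP.
by rewrite eqz_mod_dvd; apply: dvdz_trans kb; rewrite dvdzE.
Qed.

Lemma modeq_coprime d e a k : coprime d e ->
  modeq (d * e) a k = modeq d a k && modeq e a k.
Proof. by move=> de; rewrite /modeq !eqz_mod_dvd PoszM Gauss_dvdz. Qed.

(** Two classes are disjoint or meet in a single class modulo the least common multiple; the first
    case makes this an inequality. *)
Lemma count_two_mod (d e P : nat) (a b : int) : (0 < P)%N -> (d %| P)%N -> (e %| P)%N ->
  (lcmn d e * count (fun k => modeq d a k && modeq e b k) (ints P) <= P)%N.
Proof.
move=> P0 dP eP.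
have lP : (lcmn d e %| P)%N by rewrite dvdn_lcm dP.
have [|] := boolP (has (fun k => modeq d a k && modeq e b k) (ints P)); last first.
  by rewrite has_count -leqNgt leqn0 => /eqP ->; rewrite muln0.
case/hasP => h _ /andP[dh eh].
rewrite -[leqRHS](count_eq_mod h P0 lP) leq_mul2l; apply/orP; right.
apply: sub_count => k /andP[dk ek]; rewrite /modeq eqz_mod_dvd dvdzE /= dvdn_lcm.
rewrite -[d]/(`|d%:Z|%N) -[e]/(`|e%:Z|%N) -!dvdzE -!eqz_mod_dvd.
by rewrite (eqP dk) (eqP ek) (eqP dh) (eqP eh) !eqxx.
Qed.

(** Apply [1 + x <= expR x] to [x = p / (1 - p)], where [1 + x] is the inverse of [1 - p]; for
    [p <= 1/2] this [x] is at most [p + 2 p^2]. *)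
Lemma expRN_le_1B (R : realType) (p : R) : 0 <= p <= 1 / 2 ->
  expR (- (p + 2 * p ^+ 2)) <= 1 - p.
Proof.
move=> /andP[p0 p1].
have p1' : 0 < 1 - p by lra.
have le : p / (1 - p) <= p + 2 * p ^+ 2.
  rewrite ler_pdivrMr //; have : 0 <= p ^+ 2 * (1 - 2 * p) by rewrite mulr_ge0 ?sqr_ge0 //; lra.
  by rewrite !expr2; nra.
apply: (@le_trans _ _ (expR (- (p / (1 - p))))); first by rewrite ler_expR lerN2.
rewrite expRN -[leRHS]invrK lef_pV2 ?posrE ?invr_gt0 ?expR_gt0 //.
apply: le_trans (expR_ge1Dx _).
have -> : 1 + p / (1 - p) = (1 - p)^-1 by field; lra.
exact: lexx.
Qed.

Section SieveBySmoothPart.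
Variables (R : realType) (pi : nat_pred) (s : seq nat) (r : nat -> int) (P : nat).
Hypotheses (uniq_s : uniq s) (P_gt0 : (0 < P)%N) (s_dvd : forall n, n \in s -> (n %| P)%N).

Let s_gt0 n : n \in s -> (0 < n)%N.
Proof. by move=> /s_dvd; exact: dvdn_gt0. Qed.

(* p n is the density of the class of n inside a class h modulo M that meets
   it; hit h lists the moduli outside pi meeting h. *)
Let M := (P`_pi)%N.
Let good := [seq n <- s | ~~ pi.-nat n].
Let bad := [seq n <- s | pi.-nat n].
Let p (n : nat) : R := (n`_pi^')%N%:R^-1.
Let dep (n m : nat) := ~~ coprime (n`_pi^')%N (m`_pi^')%N.
Let hit h := [seq n <- good | modeq (n`_pi)%N (r n) h].
Let W h := [seq k <- ints P | modeq M h k].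

Let M_gt0 : (0 < M)%N. Proof. exact: part_gt0. Qed.

Let part_dvd_M n : n \in s -> (n`_pi %| M)%N.
Proof. by move=> ns; apply: partn_dvd => //; exact: s_dvd. Qed.

Let size_W h : (M * size (W h) = P)%N.
Proof. by rewrite size_filter; apply: count_eq_mod => //; exact: dvdn_part. Qed.

(** On the class of [h] modulo [M], a modulus in [hit h] removes one class modulo its part outside
    [pi], and the other good moduli remove nothing. Coprime parts give independence there, so the
    truncated sieve applies. *)
Let class_bound h :
  (\prod_(n <- hit h) (1 - p n)
   - \sum_(n <- hit h) \sum_(m <- hit h | (m != n) && dep n m) p n * p m)
   * (size (W h))%:R <= (count (avoids good r) (W h))%:R.
Proof.
have hit_s n : n \in hit h -> n \in s by rewrite !mem_filter => /andP[_ /andP[_]].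
have modeq_hit n k : n \in hit h -> modeq M h k -> modeq n (r n) k = modeq (n`_pi^')%N (r n) k.
  move=> nh kh; have ns := hit_s n nh.
  rewrite -{1}(partnC pi (s_gt0 ns)) modeq_coprime ?coprime_partC //.
  rewrite (modeq_dvd (r n) (part_dvd_M ns) kh).
  by move: nh; rewrite mem_filter => /andP[-> _].
have -> : count (avoids good r) (W h) =
    count (fun k => all (fun n => ~~ modeq n (r n) k) (hit h)) (W h).
  rewrite /W !count_filter; apply: eq_count => k /=.
  case kh: (modeq M h k); rewrite ?andbF//= !andbT.
  apply/allP/allP => av n.
    by rewrite mem_filter => /andP[_]; exact: av.
  move=> ng; have ns : n \in s by move: ng; rewrite mem_filter => /andP[].
  have [nh|] := boolP (n \in hit h); first exact: av.
  rewrite mem_filter ng andbT; apply: contraNN => nk.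
  rewrite -(modeq_dvd (r n) (part_dvd_M ns) kh).
  by move: nk; rewrite -{1}(partnC pi (s_gt0 ns)) modeq_coprime ?coprime_partC// => /andP[].
apply: sieve_lower_bound.
- by rewrite !filter_uniq.
- move=> n _; rewrite /p invr_ge0 ler0n /=.
  by rewrite invf_le1 ?ltr0n ?ler1n part_gt0.
move=> n t nh th tn.
rewrite /W !count_filter; set A := predI _ _; set B := predI _ _.
have nP : (n`_pi^' %| P)%N by apply: dvdn_trans (dvdn_part _ _) (s_dvd (hit_s n nh)).
have n'0 : (0 < n`_pi^')%N by exact: part_gt0.
have -> : (count B (ints P))%:R = (n`_pi^')%N%:R * (count A (ints P))%:R :> R.
  rewrite -natrM; congr _%:R.
  (* P`_rho is the largest divisor of P coprime to the rough part of n. *)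
  pose rho : nat_pred := (\pi(n`_pi^')^')%N.
  rewrite -(@count_equidistributed B (P`_rho)%N (n`_pi^')%N P (r n)) //.
  - congr (_ * _)%N; apply: eq_count => k; rewrite /A /B /=.
    case kh: (modeq M h k); last by rewrite !andbF.
    by rewrite !andbT (modeq_hit _ _ nh kh).
  - exact: dvdn_part.
  - by rewrite coprime_sym coprime_pi' ?part_gt0 // part_pnat.
  have dvd_rho d : (d %| P)%N -> coprime (n`_pi^')%N d -> (d %| P`_rho)%N.
    move=> dP cd; have d0 := dvdn_gt0 P_gt0 dP.
    rewrite -[d](@part_pnat_id rho); first exact: partn_dvd.
    by rewrite /rho -coprime_pi'.
  (* All periods occurring in [B] are coprime to the part of [n] outside [pi]: [M] has only primes
     of [pi], and each [m] in [t] satisfies [~~ dep n m]. *)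
  move=> k; rewrite /B /=; congr andb.
    apply: eq_in_all => m mt; congr (~~ _).
    have ms := hit_s m (th m mt).
    apply: (periodic_dvd _ (modeq_periodic m (r m))); apply: dvd_rho; first exact: s_dvd.
    rewrite -(partnC pi (s_gt0 ms)) coprimeMr coprime_sym coprime_partC /=.
    by have /andP[_] := tn m mt; rewrite negbK.
  apply: (periodic_dvd _ (modeq_periodic M h)); apply: dvd_rho; first exact: dvdn_part.
  by rewrite coprime_sym coprime_partC.
by rewrite /p mulKf // pnatr_eq0 -lt0n.
Qed.

(** [A] is the average of [X h] over [h] modulo [M], since [n] meets one [h] in every [n_pi], its
    [pi]-part; its quadratic term comes from [expRN_le_1B]. Likewise [beta] bounds the average of
    [betah h], and [eps] the proportion of [h] failing [G]. *)
Let A : R := \sum_(n <- good) (p n + 2 * p n ^+ 2) / (n`_pi)%N%:R.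
Let eps : R := \sum_(n <- bad) n%:R^-1.
Let beta : R := \sum_(n <- good) \sum_(m <- good | (m != n) && dep n m)
                 p n * p m / (lcmn (n`_pi)%N (m`_pi)%N)%:R.
Hypothesis p_le : forall n, n \in good -> p n <= 1 / 2.

Let X h : R := \sum_(n <- good) (p n + 2 * p n ^+ 2) * (modeq (n`_pi)%N (r n) h)%:R.
Let betah h : R := \sum_(n <- hit h) \sum_(m <- hit h | (m != n) && dep n m) p n * p m.
Let G h := all (fun n => ~~ modeq n (r n) h) bad.

Let p_ge0 n : 0 <= p n. Proof. by rewrite invr_ge0. Qed.
#[local] Hint Resolve p_ge0 : core.

(* The tangent line of exp at A replaces the average of exp (- X h) by its
   linear part: Jensen's inequality without taking roots. *)
Let class_bound_G h : G h ->
  (expR (- A) * (1 + A - X h) - betah h) * (P%:R / M%:R)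
  <= (count (avoids s r) (W h))%:R.
Proof.
move=> /allP Gh.
have -> : P%:R / M%:R = (size (W h))%:R :> R.
  by rewrite -{1}(size_W h) natrM mulrC mulKf // pnatr_eq0 -lt0n.
(* Bad moduli divide [M], so they are decided by [h] alone, and [G h] says that all of them are
   avoided. *)
have -> : count (avoids s r) (W h) = count (avoids good r) (W h).
  rewrite /W !count_filter; apply: eq_count => k /=.
  case kh: (modeq M h k); rewrite ?andbF//= !andbT.
  apply/allP/allP => av n; first by rewrite mem_filter => /andP[_]; exact: av.
  move=> ns; have [nb|ng] := boolP (pi.-nat n); last by apply: av; rewrite mem_filter ng.
  have nM : (n %| M)%N by rewrite -[n](@part_pnat_id pi) //; exact: part_dvd_M.
  by rewrite (modeq_dvd (r n) nM kh); apply: Gh; rewrite mem_filter nb.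
apply: le_trans (class_bound h).
rewrite ler_wpM2r // lerB //.
apply: (@le_trans _ _ (expR (- X h))).
  rewrite (_ : expR (- X h) = expR (- A) * expR (A - X h)); last first.
    by rewrite -expRD addKr.
  by rewrite ler_wpM2l ?expR_ge0 // -addrA expR_ge1Dx.
rewrite /X /hit big_filter [leRHS]big_mkcond /= -sumrN big_seq [leRHS]big_seq.
apply: (big_ind2 (fun x y => expR x <= y)).
- by rewrite expR0.
- by move=> x1 x2 y1 y2 le1 le2; rewrite expRD ler_pM ?expR_ge0.
move=> n ng; case: (modeq _ _ _) => /=; last by rewrite mulr0 oppr0 expR0.
by rewrite mulr1 expRN_le_1B // p_ge0 p_le.
Qed.

Let sum_X : \sum_(h <- ints M) X h = M%:R * A.
Proof.
rewrite /X exchange_big /= /A big_distrr /= big_seq [RHS]big_seq; apply: eq_bigr => n ng.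
have ns : n \in s by move: ng; rewrite mem_filter => /andP[].
rewrite -big_distrr /= sum_nat_of_bool [RHS]mulrCA; congr (_ * _).
have := count_eq_mod (r n) M_gt0 (part_dvd_M ns); set c := count _ _ => <-.
by rewrite natrM mulrAC mulfV ?mul1r // pnatr_eq0 -lt0n part_gt0.
Qed.

Let sum_beta : \sum_(h <- ints M) betah h <= M%:R * beta.
Proof.
rewrite /betah /hit /beta.
under eq_bigr do rewrite big_filter big_mkcond.
rewrite exchange_big /= big_distrr /= big_seq [leRHS]big_seq; apply: ler_sum => n ng.
have ns : n \in s by move: ng; rewrite mem_filter => /andP[].
apply: (@le_trans _ _ (\sum_(h <- ints M) \sum_(m <- good | (m != n) && dep n m)
   p n * p m * (modeq (n`_pi)%N (r n) h && modeq (m`_pi)%N (r m) h)%:R)).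
  apply: ler_sum => h _; case: ifP => _; last first.
    by rewrite sumr_ge0 // => m _; rewrite !mulr_ge0.
  rewrite big_filter_cond [leRHS]big_mkcond [leLHS]big_mkcond; apply: ler_sum => m _.
  by case: (modeq _ _ _) => /=; case: ifP => _; rewrite ?mulr1 ?mulr0.
rewrite exchange_big /= big_distrr /= big_seq_cond [leRHS]big_seq_cond.
apply: ler_sum => m /andP[mg _].
have ms : m \in s by move: mg; rewrite mem_filter => /andP[].
rewrite -big_distrr /= sum_nat_of_bool mulrCA ler_wpM2l ?mulr_ge0 //.
rewrite ler_pdivlMr ?ltr0n ?lcmn_gt0 ?part_gt0 // -natrM ler_nat mulnC.
by apply: count_two_mod => //; exact: part_dvd_M.
Qed.

Let card_G : M%:R * (1 - eps) <= (count G (ints M))%:R.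
Proof.
have := count_predC G (ints M); rewrite size_ints => MG.
rewrite mulrBr mulr1 -{1}MG natrD lerBlDr lerD2l.
rewrite /eps big_distrr /=.
apply: (@le_trans _ _ (\sum_(n <- bad) (count (modeq n (r n)) (ints M))%:R)).
  rewrite -natr_sum ler_nat -sum1_count big_mkcond /=.
  under [leqRHS]eq_bigr do rewrite -sum1_count big_mkcond /=.
  rewrite exchange_big /=; apply: leq_sum => h _; rewrite /G.
  case: allPn => // -[n nb]; rewrite negbK => nh.
  by rewrite (big_rem n) //= nh.
rewrite big_seq [leRHS]big_seq; apply: ler_sum => n.
rewrite mem_filter => /andP[nb ns].
have nM : (n %| M)%N by rewrite -[n](@part_pnat_id pi) //; exact: part_dvd_M.
by rewrite ler_pdivlMr ?ltr0n ?s_gt0 // -natrM ler_nat mulnC count_eq_mod.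
Qed.

(** Sum the class bounds over [h]. The main term arises from
    [(1 + A) (1 - eps) - A = 1 - eps (1 + A)]. *)
Lemma sieve_by_smooth_part :
  (expR (- A) * (1 - eps * (1 + A)) - beta) * P%:R <= (count (avoids s r) (ints P))%:R.
Proof.
have A_ge0 : 0 <= A.
  by rewrite sumr_ge0 // => n _; rewrite mulr_ge0 // addr_ge0 // mulr_ge0 // exprn_ge0.
have M0 : 0 < M%:R :> R by rewrite ltr0n.
have -> : (count (avoids s r) (ints P))%:R =
    \sum_(h <- ints M) (count (avoids s r) (W h))%:R :> R.
  rewrite -(count_sum_class (avoids s r) (ints P) M_gt0) natr_sum -natr_sum sum_ints natr_sum.
  by apply: eq_bigr => i _; rewrite count_filter.
(* The indicator of [G] multiplies only [1 + A]: for [h] outside [G] the summand is at most 0, hence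
   a valid bound, while [X h] can be summed over all [h], giving exactly [M * A]. *)
apply: (@le_trans _ _ (\sum_(h <- ints M)
   (expR (- A) * ((1 + A) * (G h)%:R - X h) - betah h) * (P%:R / M%:R))); last first.
  apply: ler_sum => h _; have [Gh|_] := boolP (G h).
    by rewrite mulr1; exact: class_bound_G.
  rewrite mulr0 sub0r mulrN -opprD mulNr; apply: (@le_trans _ _ 0) => //.
  rewrite oppr_le0 mulr_ge0 ?divr_ge0 // addr_ge0 ?mulr_ge0 ?expR_ge0 //.
    by rewrite sumr_ge0 // => n _; rewrite mulr_ge0 // addr_ge0 // mulr_ge0 // exprn_ge0.
  by rewrite sumr_ge0 // => n _; rewrite sumr_ge0 // => m _; rewrite mulr_ge0.
rewrite -big_distrl /= sumrB -big_distrr /= sumrB -big_distrr /= sum_X sum_nat_of_bool.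
rewrite mulrA ler_pdivlMr // mulrAC ler_wpM2r //.
move: sum_beta card_G; set C := (count _ _)%:R; set Bs := \sum_(_ <- _) _.
move=> leB leC.
apply: (@le_trans _ _ (expR (- A) * ((1 + A) * (M%:R * (1 - eps)) - M%:R * A) - M%:R * beta)).
  by rewrite le_eqVlt; apply/orP; left; apply/eqP; ring.
by rewrite lerB // ler_wpM2l ?expR_ge0 // lerB // ler_wpM2l // addr_ge0.
Qed.

End SieveBySmoothPart.

(** * Harmonic sums *)

Lemma sum_subset_le (R : numDomainType) (I : eqType) (s1 s2 : seq I) (F : I -> R) :
  uniq s1 -> uniq s2 -> {subset s1 <= s2} -> (forall i, i \in s2 -> 0 <= F i) ->
  \sum_(i <- s1) F i <= \sum_(i <- s2) F i.
Proof.
move=> u1 u2 s12 F0; rewrite [leRHS](bigID (mem s1)) /= -[X in _ <= X + _]big_filter.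
have p12 : perm_eq [seq i <- s2 | mem s1 i] s1.
  apply: uniq_perm; rewrite ?filter_uniq // => i.
  by rewrite mem_filter andb_idr //; exact: s12.
rewrite (perm_big _ p12) /=.
by rewrite lerDl big_seq_cond sumr_ge0 // => i /andP[/F0].
Qed.

Lemma prod_subset_ge (R : numDomainType) (I : eqType) (s1 s2 : seq I) (F : I -> R) :
  uniq s1 -> uniq s2 -> {subset s1 <= s2} -> (forall i, i \in s2 -> 0 <= F i <= 1) ->
  \prod_(i <- s2) F i <= \prod_(i <- s1) F i.
Proof.
move=> u1 u2 s12 F01; rewrite [leLHS](bigID (mem s1)) /= -[X in X * _ <= _]big_filter.
have p12 : perm_eq [seq i <- s2 | mem s1 i] s1.
  apply: uniq_perm; rewrite ?filter_uniq // => i.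
  by rewrite mem_filter andb_idr //; exact: s12.
rewrite (perm_big _ p12) /=.
rewrite ler_piMr //; first by rewrite big_seq prodr_ge0 // => i /s12/F01/andP[].
by rewrite big_seq_cond prodr_ile1 // => i /andP[/F01].
Qed.

Definition harmonic_sum (R : realType) (X : nat) : R := \sum_(1 <= m < X.+1) m%:R^-1.

Lemma harmonic_sum_ge0 (R : realType) X : 0 <= harmonic_sum R X.
Proof. by rewrite sumr_ge0. Qed.

(** Substitute [n = e * m] and let [m] run up to [X] instead of [X / e]. *)
Lemma sum_multiples_le (R : realType) (X e : nat) (A B : pred nat) : (0 < e)%N ->
  (forall m, A (e * m)%N -> B m) ->
  \sum_(1 <= n < X.+1 | A n && (e %| n)%N) n%:R^-1
    <= e%:R^-1 * \sum_(1 <= m < X.+1 | B m) m%:R^-1 :> R.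
Proof.
move=> e0 AB; rewrite -big_filter big_distrr /= -[leRHS]big_filter.
set s1 := seq.filter _ _; set s2 := seq.filter _ _.
have s1P n : n \in s1 -> [/\ A n, (e %| n)%N & (0 < n < X.+1)%N].
  by rewrite mem_filter mem_index_iota => /andP[/andP[]].
have -> : \sum_(i <- s1) i%:R^-1 =
    \sum_(m <- [seq (n %/ e)%N | n <- s1]) e%:R^-1 * m%:R^-1 :> R.
  rewrite big_map big_seq [RHS]big_seq; apply: eq_bigr => n /s1P[_ en _].
  by rewrite -invfM -natrM mulnC divnK.
apply: sum_subset_le.
- rewrite map_inj_in_uniq ?filter_uniq ?iota_uniq // => n m /s1P[_ en _] /s1P[_ em _] nm.
  by rewrite -(divnK en) nm divnK.
- by rewrite filter_uniq ?iota_uniq.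
- move=> _ /mapP[n /s1P[An en /andP[n0 nX]] ->].
  rewrite mem_filter mem_index_iota divn_gt0 // dvdn_leq //=.
  rewrite (leq_ltn_trans (leq_div n e)) // andbT; apply: AB.
  by rewrite mulnC divnK.
by move=> m _; rewrite mulr_ge0.
Qed.

Lemma sum_inv_multiples_le (R : realType) (X e : nat) : (0 < e)%N ->
  \sum_(1 <= n < X.+1 | (e %| n)%N) n%:R^-1 <= e%:R^-1 * harmonic_sum R X :> R.
Proof. by move=> e0; apply: (@sum_multiples_le R X e predT predT). Qed.

(** Each [1 / (m + 1)] is at most [ln (m + 1) - ln m], and these differences telescope. *)
Lemma harmonic_sum_le (R : realType) (X : nat) : (0 < X)%N ->
  harmonic_sum R X <= 1 + ln X%:R.
Proof.
case: X => // X _; rewrite /harmonic_sum big_ltn // invr1 lerD2l.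
apply: (@le_trans _ _ (\sum_(1 <= m < X.+1) (ln m.+1%:R - ln m%:R))); last first.
  by rewrite telescope_sumr // ln1 subr0.
rewrite -[X.+2]/(X.+1.+1) big_add1 /= big_nat [leRHS]big_nat; apply: ler_sum => m /andP[m0 _].
have m0' : 0 < m%:R :> R by rewrite ltr0n.
have mS : 0 < m.+1%:R :> R by rewrite ltr0n.
rewrite -lerN2 opprB -ln_div ?posrE //.
apply: (@le_trans _ _ (ln (1 - m.+1%:R^-1))).
  rewrite le_eqVlt; apply/orP; left; apply/eqP; congr ln.
  by rewrite -natr1; field; rewrite natr1 pnatr_eq0.
have : -1 < - m.+1%:R^-1 :> R by rewrite ltrN2 invf_lt1 ?ltr1n.
by move=> /le_ln1Dx.
Qed.

(** Telescoping, from [1 / (q + 1)^2 <= 1 / q - 1 / (q + 1)]. *)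
Lemma sum_inv_sqr_le (R : realType) (Q X : nat) : (0 < Q)%N ->
  \sum_(Q.+1 <= q < X) (q%:R ^+ 2)^-1 <= Q%:R^-1 :> R.
Proof.
move=> Q0; have [XQ|QX] := leqP X Q.+1; first by rewrite big_geq // invr_ge0.
case: X QX => // X QX; rewrite big_add1 /=.
apply: (@le_trans _ _ (\sum_(Q <= q < X) ((- q.+1%:R^-1) - (- q%:R^-1)))); last first.
  rewrite telescope_sumr; last by rewrite ltnW.
  by rewrite opprK addrC lerBlDr lerDl invr_ge0.
rewrite big_nat [leRHS]big_nat; apply: ler_sum => q /andP[Qq _].
have q0 : 0 < q%:R :> R by rewrite ltr0n (leq_trans Q0).
have qS : 0 < q.+1%:R :> R by rewrite ltr0n.
have -> : - q.+1%:R^-1 - - q%:R^-1 = (q.+1%:R * q%:R)^-1 :> R.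
  by rewrite -natr1; field; rewrite natr1 !pnatr_eq0 -lt0n -(ltr0n R) q0.
by rewrite lef_pV2 ?posrE ?mulr_gt0 ?exprn_gt0 // expr2 ler_pM2l // ler_nat.
Qed.

Lemma prod_one_sub_inv (R : realType) (a b : nat) : (0 < a <= b)%N ->
  \prod_(a.+1 <= n < b.+1) (1 - n%:R^-1) = a%:R / b%:R :> R.
Proof.
move=> /andP[a0]; elim: b => [|b IHb]; first by rewrite leqNgt a0.
rewrite leq_eqVlt => /orP[/eqP <-|ab].
  by rewrite big_geq // divff // pnatr_eq0 -lt0n.
rewrite big_nat_recr //= IHb // -[b.+1%:R]natr1.
have b0 : b%:R != 0 :> R by rewrite pnatr_eq0 -lt0n (leq_trans a0).
by field; rewrite b0 natr1 pnatr_eq0.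
Qed.

(** * Pairs of moduli with a common large prime *)

Definition smooth (Q : nat) : nat_pred := [pred p | (p <= Q)%N].

(** With [g] the gcd of the smooth parts, the left side is [g / (n m)]. A common prime [q > Q] of
    the rough parts makes [q * g] divide both [n] and [m], so the summand at [(q, g)] already
    suffices. In the double sum [n] and [m] are separated. *)
Lemma gcd_pair_term_le (R : realType) (Q X n m : nat) : (0 < n <= X)%N -> (0 < m <= X)%N ->
  ~~ coprime (n`_(smooth Q)^')%N (m`_(smooth Q)^')%N ->
  (n`_(smooth Q)^')%N%:R^-1 * (m`_(smooth Q)^')%N%:R^-1
    / (lcmn (n`_(smooth Q))%N (m`_(smooth Q))%N)%:R
  <= \sum_(Q.+1 <= q < X.+1) \sum_(1 <= d < X.+1)
       d%:R * ((q * d %| n)%N%:R * n%:R^-1) * ((q * d %| m)%N%:R * m%:R^-1) :> R.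
Proof.
move=> /andP[n0 nX] /andP[m0 mX] ncop.
set pi := smooth Q in ncop *.
set g := gcdn (n`_pi)%N (m`_pi)%N.
have g0 : (0 < g)%N by rewrite gcdn_gt0 part_gt0.
have -> : (n`_pi^')%N%:R^-1 * (m`_pi^')%N%:R^-1 / (lcmn (n`_pi)%N (m`_pi)%N)%:R
     = g%:R * n%:R^-1 * m%:R^-1 :> R.
  rewrite -{3}(partnC pi n0) -{3}(partnC pi m0) !natrM.
  have lg : (lcmn (n`_pi)%N (m`_pi)%N)%:R * g%:R = (n`_pi)%N%:R * (m`_pi)%N%:R :> R.
    by rewrite -!natrM muln_lcm_gcd.
  have nz k rho : (k`_rho)%N%:R != 0 :> R by rewrite pnatr_eq0 -lt0n part_gt0.
  have gz : g%:R != 0 :> R by rewrite pnatr_eq0 -lt0n.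
  have lz : (lcmn (n`_pi)%N (m`_pi)%N)%:R != 0 :> R.
    by rewrite pnatr_eq0 -lt0n lcmn_gt0 !part_gt0.
  have -> : (lcmn (n`_pi)%N (m`_pi)%N)%:R = (n`_pi)%N%:R * (m`_pi)%N%:R / g%:R :> R.
    by rewrite -lg mulfK.
  by field; rewrite gz !nz.
have [q [q_pr qn qm]] : exists q, [/\ prime q, (q %| n`_pi^')%N & (q %| m`_pi^')%N].
  exists (pdiv (gcdn (n`_pi^')%N (m`_pi^')%N)); set c := gcdn _ _.
  have c1 : (1 < c)%N by rewrite ltn_neqAle eq_sym ncop gcdn_gt0 part_gt0.
  rewrite pdiv_prime //; split => //; apply: dvdn_trans (pdiv_dvd c) _.
    exact: dvdn_gcdl.
  exact: dvdn_gcdr.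
have qQ : (Q < q)%N.
  have /pnatP -/(_ (part_gt0 _ _)) h := part_pnat (pi^')%N n.
  have : q \in pi^'%N by exact: h.
  by rewrite !inE -ltnNge.
have qdvd k : (0 < k)%N -> (q %| k`_pi^')%N -> (g %| k`_pi)%N -> (q * g %| k)%N.
  move=> k0 qk gk; rewrite -(partnC pi k0) mulnC; exact: dvdn_mul.
have qgn : (q * g %| n)%N by apply: qdvd => //; rewrite dvdn_gcdl.
have qgm : (q * g %| m)%N by apply: qdvd => //; rewrite dvdn_gcdr.
have qX : (q <= X)%N.
  by apply: leq_trans nX; apply: dvdn_leq => //; apply: dvdn_trans qn (dvdn_part _ _).
have gX : (g <= X)%N.
  by apply: leq_trans nX; apply: dvdn_leq => //; apply: dvdn_trans (dvdn_gcdl _ _) (dvdn_part _ _).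
rewrite (big_rem q) ?mem_index_iota ?qQ //=; apply: ler_wpDr.
  by rewrite sumr_ge0 // => q' _; rewrite sumr_ge0 // => d _; rewrite !mulr_ge0.
rewrite (big_rem g) ?mem_index_iota ?g0 //=; apply: ler_wpDr.
  by rewrite sumr_ge0 // => d _; rewrite !mulr_ge0.
by rewrite qgn qgm !mul1r.
Qed.

(** For fixed [q] and [d], both sums over multiples of [q * d] are at most [H / (q d)], which leaves
    [H^2 / (q^2 d)]. Summing over [d] gives a third factor [H], and summing over [q > Q] gives
    [1 / Q]. *)
Lemma gcd_sum_le (R : realType) (Q X : nat) (s : seq nat) : (0 < Q)%N -> uniq s ->
  (forall n, n \in s -> (0 < n <= X)%N) ->
  \sum_(n <- s) \sum_(m <- s | (m != n) &&
      ~~ coprime (n`_(smooth Q)^')%N (m`_(smooth Q)^')%N)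
    (n`_(smooth Q)^')%N%:R^-1 * (m`_(smooth Q)^')%N%:R^-1
      / (lcmn (n`_(smooth Q))%N (m`_(smooth Q))%N)%:R
  <= harmonic_sum R X ^+ 3 / Q%:R.
Proof.
move=> Q0 us sX.
pose T q d n : R := (q * d %| n)%N%:R * n%:R^-1.
have T0 q d n : 0 <= T q d n by rewrite mulr_ge0.
have sumT q d : (0 < q)%N -> (0 < d)%N ->
    \sum_(n <- s) T q d n <= (q * d)%N%:R^-1 * harmonic_sum R X.
  move=> q0 d0; apply: le_trans (sum_inv_multiples_le R X _); last by rewrite muln_gt0 q0.
  rewrite [leRHS]big_mkcond /=.
  apply: (@le_trans _ _ (\sum_(1 <= n < X.+1) T q d n)).
    apply: sum_subset_le => //; first exact: iota_uniq.
    by move=> n /sX; rewrite mem_index_iota.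
  by apply: ler_sum => n _; rewrite /T; case: ifP => _; rewrite ?mul1r ?mul0r.
apply: (@le_trans _ _ (\sum_(n <- s) \sum_(m <- s)
    \sum_(Q.+1 <= q < X.+1) \sum_(1 <= d < X.+1) d%:R * T q d n * T q d m)).
  rewrite big_seq [leRHS]big_seq; apply: ler_sum => n ns.
  rewrite big_mkcond /= big_seq [leRHS]big_seq; apply: ler_sum => m ms.
  case: ifP => [/andP[_ ncop]|_]; first exact: gcd_pair_term_le (sX n ns) (sX m ms) ncop.
  by rewrite sumr_ge0 // => q _; rewrite sumr_ge0 // => d _; rewrite !mulr_ge0.
apply: (@le_trans _ _ (\sum_(Q.+1 <= q < X.+1) \sum_(1 <= d < X.+1)
    d%:R * (\sum_(n <- s) T q d n) * (\sum_(n <- s) T q d n))).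
  under eq_bigr => n _ do rewrite exchange_big /=.
  rewrite exchange_big /= ; apply: ler_sum => q _.
  under eq_bigr => n _ do rewrite exchange_big /=.
  rewrite exchange_big /= ; apply: ler_sum => d _.
  rewrite -mulrA big_distrlr big_distrr /= le_eqVlt; apply/orP; left; apply/eqP.
  apply: eq_bigr => n _; rewrite big_distrr /=; apply: eq_bigr => m _.
  by rewrite mulrA.
set H := harmonic_sum R X; have H0 : 0 <= H := harmonic_sum_ge0 R X.
apply: (@le_trans _ _ (\sum_(Q.+1 <= q < X.+1) \sum_(1 <= d < X.+1)
    (q%:R ^+ 2)^-1 * (d%:R^-1 * H ^+ 2))).
  rewrite big_nat [leRHS]big_nat; apply: ler_sum => q /andP[q0 _].
  rewrite big_nat [leRHS]big_nat; apply: ler_sum => d /andP[d0 _].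
  have {}q0 : (0 < q)%N by apply: leq_ltn_trans q0.
  have -> : (q%:R ^+ 2)^-1 * (d%:R^-1 * H ^+ 2) =
    d%:R * ((q * d)%N%:R^-1 * H) * ((q * d)%N%:R^-1 * H) :> R.
    by rewrite natrM; field; rewrite !pnatr_eq0 -!lt0n d0.
  by rewrite ler_pM ?mulr_ge0 ?sumr_ge0 // ?sumT // ler_wpM2l // sumT.
under eq_bigr => q _ do rewrite -big_distrr /= -big_distrl /=.
rewrite -big_distrl /= -/(harmonic_sum R X) -/H -exprS mulrC.
by rewrite ler_wpM2l ?exprn_ge0 // sum_inv_sqr_le.
Qed.

(** * Smooth numbers *)

Lemma sum_prime_powers_dvd (R : realType) (B p n : nat) : (0 < n <= B)%N -> prime p ->
  \sum_(1 <= v < B.+1 | (p ^ v %| n)%N) ln p%:R = (logn p n)%:R * ln p%:R :> R.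
Proof.
move=> /andP[n0 nB] p_pr.
have lB : (logn p n <= B)%N by exact: leq_trans (ltnW (ltn_logl p n0)) nB.
under eq_bigl => v do rewrite pfactor_dvdn //.
rewrite big_mkcond /= (big_cat_nat (n := (logn p n).+1)) //=.
rewrite [X in _ + X]big_nat [X in _ + X]big1 ?addr0; last first.
  by move=> v /andP[lv _]; rewrite leqNgt lv.
rewrite big_nat (eq_bigr (fun=> ln p%:R)) => [|v /andP[_ vl]]; last by rewrite -ltnS vl.
by rewrite -big_nat sumr_const_nat subSS subn0 mulr_natl.
Qed.

(** The common bound [B] keeps the ranges of [p] and [v] independent of [n], so that they can be
    exchanged with sums over [n]. *)
Lemma ln_sum_prime_powers (R : realType) (B n : nat) : (0 < n <= B)%N ->
  ln n%:R = \sum_(0 <= p < B.+1 | prime p) \sum_(1 <= v < B.+1 | (p ^ v %| n)%N) ln p%:R :> R.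
Proof.
move=> nB; have /andP[n0 nB'] := nB.
rewrite -{1}(partnT n0) (widen_partn predT nB').
have -> : (\prod_(0 <= p < B.+1 | p \in predT) p ^ logn p n
    = \prod_(0 <= p < B.+1 | prime p) p ^ logn p n)%N.
  rewrite [RHS]big_mkcond /=; apply: eq_bigr => p _; case: ifP => // p_pr.
  by rewrite lognE p_pr.
rewrite [RHS](eq_bigr (fun p => (logn p n)%:R * ln p%:R)); last first.
  by move=> p p_pr; exact: sum_prime_powers_dvd.
elim: (index_iota _ _) => [|p s IHs]; first by rewrite !big_nil ln1.
rewrite !big_cons; case: ifP => // p_pr.
have p0 : 0 < p%:R :> R by rewrite ltr0n prime_gt0.
rewrite natrM natrX lnM ?posrE ?exprn_gt0 // ?IHs ?lnXn ?mulr_natl //.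
by rewrite ltr0n prodn_cond_gt0 // => q q_pr; rewrite expn_gt0 prime_gt0.
Qed.

(* Compare both sides of the prime power expansion of the product of the
   m <= Q, using Q %/ d >= Q / (2 d) for d <= Q. *)
Lemma mertens_upper (R : realType) (B Q : nat) : (0 < Q <= B)%N ->
  \sum_(0 <= p < B.+1 | prime p) \sum_(1 <= v < B.+1 | (p ^ v <= Q)%N)
    ln p%:R * (p ^ v)%N%:R^-1 <= 2 * ln Q%:R :> R.
Proof.
move=> /andP[Q0 QB].
have Q0' : 0 < Q%:R :> R by rewrite ltr0n.
have lnp p : prime p -> 0 <= ln p%:R :> R by move=> p_pr; rewrite ln_ge0 // ler1n prime_gt0.
have le1 : \sum_(1 <= m < Q.+1) ln m%:R <= Q%:R * ln Q%:R :> R.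
  rewrite mulr_natl -[X in _ *+ X](subn0 Q) -subSS -sumr_const_nat.
  rewrite big_nat [leRHS]big_nat; apply: ler_sum => m /andP[m0 mQ].
  by rewrite ler_ln ?posrE ?ltr0n // ler_nat -ltnS.
suff : Q%:R / 2 * \sum_(0 <= p < B.+1 | prime p) \sum_(1 <= v < B.+1 | (p ^ v <= Q)%N)
    ln p%:R * (p ^ v)%N%:R^-1 <= Q%:R * ln Q%:R :> R.
  set Z := \sum_(_ <= _ < _ | _) _.
  by rewrite -mulrA ler_pM2l // => ?; lra.
apply: le_trans le1.
rewrite [leRHS]big_nat.
rewrite (eq_bigr (fun m => \sum_(0 <= p < B.+1 | prime p) \sum_(1 <= v < B.+1)
  if (p ^ v %| m)%N then ln p%:R else 0)) => [|m /andP[m0 mQ]]; last first.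
  rewrite (@ln_sum_prime_powers R B) ?m0 ?(leq_trans _ QB) //.
  by apply: eq_bigr => p _; rewrite big_mkcond.
rewrite -big_nat exchange_big /= big_distrr /=; apply: ler_sum => p p_pr.
rewrite exchange_big /= big_distrr /= big_mkcond /=; apply: ler_sum => v _.
have -> : \sum_(1 <= m < Q.+1) (if (p ^ v %| m)%N then ln p%:R else 0) =
   (Q %/ p ^ v)%N%:R * ln p%:R :> R.
  rewrite divn_count_dvd natr_sum big_distrl /=; apply: eq_bigr => m _.
  by case: ifP; rewrite ?mul1r ?mul0r.
case: ifP => pQ; last by rewrite mulr_ge0 // lnp.
rewrite mulrCA mulrC ler_wpM2r ?lnp //.
have pv0 : (0 < p ^ v)%N by rewrite expn_gt0 prime_gt0.
rewrite ler_pdivrMr ?ltr0n // ler_pdivrMr // -!natrM ler_nat.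
have := ltn_ceil Q pv0; have : (0 < Q %/ p ^ v)%N by rewrite divn_gt0.
move: (Q %/ p ^ v)%N (p ^ v)%N => a b; nia.
Qed.

(** Stronger than smoothness: every prime power dividing [n] is at most [Q], so removing one shrinks
    [n] by a factor at most [Q]. *)
Definition powersmooth (Q n : nat) := all (fun p => p ^ logn p n <= Q)%N (primes n).

Lemma powersmooth_le Q n p v : prime p -> (0 < n)%N -> powersmooth Q n -> (0 < v)%N ->
  (p ^ v %| n)%N -> (p ^ v <= Q)%N.
Proof.
move=> p_pr n0 /allP ps v0 pn.
have vl : (v <= logn p n)%N by rewrite -pfactor_dvdn.
have pp : p \in primes n by rewrite -logn_gt0 (leq_trans v0).
by apply: leq_trans (ps p pp); rewrite leq_exp2l // prime_gt1.
Qed.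

Lemma powersmooth_mulr Q d n : (0 < d)%N -> powersmooth Q (d * n) -> powersmooth Q n.
Proof.
move=> d0; have [->|n0] := posnP n; first by [].
move=> /allP ps; apply/allP => p pn.
apply: leq_trans (ps p _); last by rewrite primesM // pn orbT.
rewrite leq_pexp2l ?lognM ?leq_addl //.
by move: pn; rewrite mem_primes => /andP[/prime_gt0].
Qed.

Definition powersmooth_tail (R : realType) (Q X j : nat) : R :=
  \sum_(1 <= n < X.+1 | powersmooth Q n && (Q ^ j <= n)%N) n%:R^-1.

Lemma powersmooth_tail_ge0 (R : realType) Q X j : 0 <= powersmooth_tail R Q X j.
Proof. by rewrite sumr_ge0. Qed.

(* Write the logarithm of each n in the tail as the sum of ln p over the prime
   powers p ^ v dividing n, all at most Q, and remove p ^ v from n. *)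
Lemma powersmooth_tail_rec (R : realType) (Q X j : nat) : (1 < Q)%N ->
  j.+1%:R * powersmooth_tail R Q X j.+1 <= 2 * powersmooth_tail R Q X j.
Proof.
move=> Q1; have Q0 := ltnW Q1.
have lnQ : 0 < ln Q%:R :> R by rewrite ln_gt0 // ltr1n.
rewrite -(ler_pM2l lnQ) mulrA mulrCA [leRHS]mulrA.
set T := powersmooth_tail R Q X j.
(* A bound both for the [n] in the tail and for [Q], as the two prime power sums require. *)
pose B := (X + Q)%N.
apply: (@le_trans _ _ (\sum_(1 <= n < X.+1 | powersmooth Q n && (Q ^ j.+1 <= n)%N)
   \sum_(0 <= p < B.+1 | prime p) \sum_(1 <= v < B.+1)
    (if (p ^ v %| n)%N then ln p%:R * n%:R^-1 else 0))).
  rewrite /powersmooth_tail big_distrr /= big_nat_cond [leRHS]big_nat_cond.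
  apply: ler_sum => n /andP[/andP[n0 nX] /andP[_ Qn]].
  have n0' : 0 < n%:R :> R by rewrite ltr0n.
  have -> : \sum_(0 <= p < B.+1 | prime p) \sum_(1 <= v < B.+1)
    (if (p ^ v %| n)%N then ln p%:R * n%:R^-1 else 0) = ln n%:R * n%:R^-1 :> R.
    rewrite (@ln_sum_prime_powers R B) ?n0 ?(leq_trans _ (leq_addr _ _)) // big_distrl /=.
    by apply: eq_bigr => p _; rewrite big_distrl /= [RHS]big_mkcond.
  rewrite ler_wpM2r ?invr_ge0 ?ler0n // mulrC mulr_natl -lnXn ?ltr0n // -natrX.
  by rewrite ler_ln ?posrE ?ltr0n ?expn_gt0 ?Q0 // ler_nat.
rewrite exchange_big /=.
apply: (@le_trans _ _ (\sum_(0 <= p < B.+1 | prime p)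
  \sum_(1 <= v < B.+1 | (p ^ v <= Q)%N) ln p%:R * (p ^ v)%N%:R^-1 * T)); last first.
  under eq_bigr => p _ do rewrite -big_distrl /=.
  rewrite -big_distrl /= ler_wpM2r ?powersmooth_tail_ge0 //.
  by rewrite mertens_upper // Q0 leq_addl.
apply: ler_sum => p p_pr; have p0 := prime_gt0 p_pr.
have lnp : 0 <= ln p%:R :> R by rewrite ln_ge0 // ler1n.
rewrite exchange_big /= [leRHS]big_mkcond /= big_nat [leRHS]big_nat.
apply: ler_sum => v /andP[v0 _].
rewrite -big_mkcondr /=; case: ifP => pQ; last first.
  rewrite big_nat_cond big_pred0 // => n; apply/negbTE/negP.
  move=> /andP[/andP[n0 _] /andP[/andP[ps _] pn]].
  by move: pQ; rewrite (powersmooth_le p_pr n0 ps v0 pn).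
rewrite -big_distrr /= -mulrA ler_wpM2l //.
have pv0 : (0 < p ^ v)%N by rewrite expn_gt0 p0.
(* With [n = p ^ v * m], the cofactor [m] is still powersmooth, and [p ^ v <= Q] gives
   [m >= Q ^ j]. *)
apply: sum_multiples_le => // m /andP[ps Qm].
rewrite (powersmooth_mulr pv0 ps) /=.
by rewrite -(leq_pmul2l Q0) -expnS (leq_trans Qm) // leq_mul2r pQ orbT.
Qed.

Lemma powersmooth_tail_le (R : realType) (Q X k : nat) : (1 < Q)%N ->
  powersmooth_tail R Q X k <= 2 ^+ k / k`!%:R * harmonic_sum R X.
Proof.
move=> Q1; elim: k => [|k IHk].
  rewrite expr0 fact0 invr1 !mul1r /powersmooth_tail /harmonic_sum big_mkcond /=.
  by apply: ler_sum => n _; case: ifP => // _; rewrite invr_ge0.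
rewrite -(ler_pM2l (_ : 0 < k.+1%:R)) ?ltr0n //.
apply: le_trans (powersmooth_tail_rec R X k Q1) _.
have -> : k.+1%:R * (2 ^+ k.+1 / (k.+1)`!%:R * harmonic_sum R X)
   = 2 * (2 ^+ k / k`!%:R * harmonic_sum R X) :> R.
  rewrite factS natrM exprS; field.
  by rewrite addrC natr1 !pnatr_eq0 -!lt0n fact_gt0.
by rewrite ler_pM2l.
Qed.

(** If [p ^ l] exactly divides [n] and exceeds [D ^ 3 >= p], then [l >= 2]. Take [d = p ^ l./2]: as
    [3 * l./2 >= l], its cube exceeds [D ^ 3]. This is why the smoothness bound is a cube. *)
Lemma large_square_divisor (D n : nat) : (0 < n)%N -> (smooth (D ^ 3)).-nat n ->
  ~~ powersmooth (D ^ 3) n -> exists2 d, (D < d)%N & (d ^ 2 %| n)%N.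
Proof.
move=> n0 sm /allPn[p pn]; rewrite -ltnNge; set l := logn p n => pl.
have p_pr : prime p by move: pn; rewrite mem_primes => /andP[].
have pD : (p <= D ^ 3)%N.
  by move/pnatP: sm => /(_ n0 p p_pr); apply; move: pn; rewrite mem_primes => /and3P[].
have l2 : (2 <= l)%N.
  by rewrite leqNgt; apply/negP => l1; case: l l1 pl => [|[|//]] _;
    rewrite ltnNge ?expn1 ?pD // expn0 (leq_trans (prime_gt0 p_pr)).
exists (p ^ l./2)%N; last first.
  rewrite -expnM muln2; apply: dvdn_trans (pfactor_dvdnn p n); apply: dvdn_exp2l.
  by rewrite -[leqRHS]odd_double_half leq_addl.
rewrite -(@ltn_exp2r _ _ 3) //; apply: leq_trans pl _.
rewrite -expnM leq_exp2l ?prime_gt1 //.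
by rewrite -{1}[l]odd_double_half; case: (odd l) l2; rewrite -?muln2 /=; lia.
Qed.

(** A smooth [n] is either powersmooth, hence in the tail with exponent [k], or a multiple of some
    [d ^ 2] with [d > D]; the latter contribute at most [H / D]. *)
Lemma smooth_sum_le (R : realType) (D X k : nat) (s : seq nat) : (1 < D)%N -> uniq s ->
  (forall n, n \in s -> (D ^ 3) ^ k <= n <= X)%N ->
  \sum_(n <- s | (smooth (D ^ 3)).-nat n) n%:R^-1
    <= harmonic_sum R X * (2 ^+ k / k`!%:R + D%:R^-1).
Proof.
move=> D1 us sX; set Q := (D ^ 3)%N in sX *.
have D0 := ltnW D1.
have Q1 : (1 < Q)%N by rewrite -(exp1n 3) ltn_exp2r.
have H0 := harmonic_sum_ge0 R X.
have sX' n : n \in s -> (0 < n < X.+1)%N.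
  move=> /sX /andP[Qn nX]; rewrite ltnS nX andbT (leq_trans _ Qn) //.
  by rewrite expn_gt0 (ltnW Q1).
rewrite -big_filter mulrDr.
apply: (@le_trans _ _ (\sum_(n <- [seq n <- s | (smooth Q).-nat n])
   ((powersmooth Q n && (Q ^ k <= n)%N)%:R * n%:R^-1
    + \sum_(D.+1 <= d < X.+1) (d ^ 2 %| n)%N%:R * n%:R^-1))).
  rewrite big_seq [leRHS]big_seq; apply: ler_sum => n; rewrite mem_filter => /andP[sm ns].
  have /andP[n0 nX] := sX' n ns; have /andP[Qn _] := sX n ns.
  have [ps|ps] := boolP (powersmooth Q n).
    by rewrite Qn mul1r lerDl sumr_ge0 // => d _; rewrite mulr_ge0.
  rewrite mul0r add0r; have [d Dd dn] := large_square_divisor n0 sm ps.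
  have dX : (d <= X)%N.
    rewrite -ltnS (leq_ltn_trans _ nX) //; apply: leq_trans (dvdn_leq n0 dn).
    by rewrite expnS expn1 leq_pmulr // (leq_ltn_trans _ Dd).
  rewrite (big_rem d) ?mem_index_iota ?Dd //= dn mul1r lerDl.
  by rewrite sumr_ge0 // => ? _; rewrite mulr_ge0.
have sub (F : nat -> R) : (forall n, 0 <= F n) ->
    \sum_(n <- [seq n <- s | (smooth Q).-nat n]) F n <= \sum_(1 <= n < X.+1) F n.
  move=> F0; apply: sum_subset_le => //; rewrite ?filter_uniq ?iota_uniq //.
  by move=> n; rewrite mem_filter mem_index_iota => /andP[_ /sX'].
rewrite big_split /=; apply: lerD.
  rewrite mulrC; apply: le_trans (powersmooth_tail_le R X k Q1).
  apply: le_trans (sub _ _) _; first by move=> n; rewrite mulr_ge0.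
  rewrite /powersmooth_tail [leRHS]big_mkcond /=; apply: ler_sum => n _.
  by case: ifP => _; rewrite ?mul1r ?mul0r.
rewrite exchange_big /=.
apply: (@le_trans _ _ (\sum_(D.+1 <= d < X.+1) (d%:R ^+ 2)^-1 * harmonic_sum R X)).
  rewrite big_nat [leRHS]big_nat; apply: ler_sum => d /andP[Dd _].
  apply: le_trans (sub _ _) _; first by move=> n; rewrite mulr_ge0.
  rewrite -natrX; apply: le_trans (sum_inv_multiples_le R X _); last first.
    by rewrite expn_gt0 (leq_ltn_trans _ Dd).
  rewrite [leRHS]big_mkcond /=; apply: ler_sum => n _.
  by case: ifP => _; rewrite ?mul1r ?mul0r.
by rewrite -big_distrl /= mulrC ler_wpM2l // sum_inv_sqr_le.
Qed.

(** * A bound for fixed parameters *)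

Section DensityCount.
Variables (R : realType) (S : {fset nat}).
Hypothesis S_gt0 : forall n, n \in S -> (0 < n)%N.
Let P := (\prod_(n <- S) n)%N.

Lemma prod_fset_gt0 : (0 < P)%N.
Proof. by rewrite /P big_seq prodn_cond_gt0. Qed.

Lemma dvd_prod_fset n : n \in S -> (n %| P)%N.
Proof. by move=> nS; rewrite /P (big_rem n) //= dvdn_mulr. Qed.

Lemma density_uncoveredE r :
  density R (uncovered S r) = (count (avoids S r) (ints P))%:R / P%:R.
Proof.
apply/cvg_lim => //; rewrite count_intsE; apply: cvg_proportion_periodic.
  exact: prod_fset_gt0.
by apply: avoids_periodic => n; exact: dvd_prod_fset.
Qed.

Lemma delta_minus_le_alpha : delta_minus R S <= alpha R S.
Proof.
have [r rS] := exists_residues R (ints P) (fset_uniq S) (introT allP S_gt0).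
have [r0 _ rmin] := delta_minus_min R S_gt0.
apply: le_trans (rmin r) _; rewrite density_uncoveredE.
by rewrite ler_pdivrMr ?ltr0n ?prod_fset_gt0 //; move: rS; rewrite size_ints.
Qed.

Lemma delta_minus_ge0 : 0 <= delta_minus R S.
Proof.
have [r0 <- _] := delta_minus_min R S_gt0.
by rewrite density_uncoveredE divr_ge0.
Qed.

End DensityCount.

Lemma rough_part_gt (Q n : nat) : (0 < n)%N -> ~~ (smooth Q).-nat n ->
  (Q < n`_(smooth Q)^')%N.
Proof.
move=> n0 nsm; set m := (n`_(smooth Q)^')%N.
have m0 : (0 < m)%N by exact: part_gt0.
have m1 : (1 < m)%N.
  rewrite ltn_neqAle eq_sym m0 andbT partn_eq1 //.
  by apply: contraNN nsm => h; rewrite -[_.-nat n]pnatNK.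
apply: leq_trans (pdiv_leq m0).
have /pnatP -/(_ m0) := part_pnat ((smooth Q)^')%N n.
by move/(_ _ (pdiv_prime m1) (pdiv_dvd m)); rewrite !inE -ltnNge.
Qed.

Section FixedInterval.
Variables (R : realType) (N K : R) (S : {fset nat}).
Hypotheses (N_ge : 20 <= N) (K_gt1 : 1 < K).
Hypothesis S_in : forall n : nat, n \in S -> N < n%:R <= K * N.

Let N_gt0 : 0 < N. Proof. by apply: lt_le_trans N_ge. Qed.
Let K_gt0 : 0 < K. Proof. by apply: lt_trans K_gt1. Qed.

Let S_gt20 n : n \in S -> (20 < n)%N.
Proof. by move=> /S_in/andP[Nn _]; rewrite -(ltr_nat R); apply: le_lt_trans Nn. Qed.

Let S_gt0 n : n \in S -> (0 < n)%N.
Proof. by move=> /S_gt20; exact: leq_trans. Qed.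

Let inv_bound n : n \in S -> 0 < (n%:R^-1 : R) <= 1 / 2.
Proof.
move=> nS; have n0 := S_gt0 nS.
rewrite invr_gt0 ltr0n n0 /= div1r lef_pV2 ?posrE ?ltr0n //.
by rewrite ler_nat ltnW // (leq_trans _ (S_gt20 nS)).
Qed.

Lemma alpha_gt0 : 0 < alpha R S.
Proof.
rewrite /alpha big_seq; apply: prodr_gt0 => n /inv_bound /andP[_ h].
lra.
Qed.

(** Enlarging [S] to all integers of [(N, KN]] only lowers the product, which then telescopes to
    [a / b] with [a], [b] the integer parts of [N] and [K N]; moreover [a >= N / 2]. *)
Lemma alpha_lower : (2 * K)^-1 <= alpha R S.
Proof.
have hN := N_ge; have hK := K_gt1.
pose a := Num.truncn N; pose b := Num.truncn (K * N).
have KN0 : 0 <= K * N by rewrite ltW // mulr_gt0.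
have /andP[aN Na] := truncn_itv (ltW N_gt0); have /andP[bKN _] := truncn_itv KN0.
rewrite -/a -/b in aN Na bKN.
have a19 : 19 <= a%:R :> R by rewrite -natr1 in Na; lra.
have a0 : (0 < a)%N by rewrite -(ltr0n R) (lt_le_trans _ a19).
have ab : (a <= b)%N.
  by rewrite truncn_ge_nat // (le_trans aN) // ler_peMl // ltW.
have b0 : 0 < b%:R :> R by rewrite ltr0n (leq_trans a0).
apply: (@le_trans _ _ (a%:R / b%:R)).
  rewrite ler_pdivlMr // mulrC ler_pdivrMr ?mulr_gt0 //.
  apply: le_trans bKN _; rewrite -natr1 in Na.
  rewrite [leRHS](_ : _ = K * (2 * a%:R)); last by ring.
  by rewrite ler_wpM2l ?(ltW K_gt0) //; lra.
rewrite -prod_one_sub_inv ?a0 //; apply: prod_subset_ge.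
- exact: fset_uniq.
- exact: iota_uniq.
- move=> n nS; have /andP[Nn nKN] := S_in nS.
  rewrite mem_index_iota ltnS truncn_ge_nat // nKN andbT.
  by rewrite -(ltr_nat R) (le_lt_trans aN).
move=> n; rewrite mem_index_iota => /andP[an _].
have n0 : (0 < n)%N by apply: leq_trans an.
by rewrite subr_ge0 invf_le1 ?ltr0n // ler1n n0 /= lerBlDr lerDl invr_ge0.
Qed.

Let a0 : R := \sum_(n <- S) n%:R^-1.

Lemma alpha_le_expR : alpha R S <= expR (- a0).
Proof.
rewrite /alpha /a0 -sumrN big_seq [X in expR X]big_seq.
set al := \prod_(_ <- _ | _) _; set x := \sum_(_ <- _ | _) _.
suff : al <= expR x /\ 0 <= al by case.
apply: (big_ind2 (fun x y => x <= expR y /\ 0 <= x)) => [|x1 x2 y1 y2 [h1 h1'] [h2 h2']|n nS].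
- by rewrite expR0.
- by rewrite expRD ler_pM // mulr_ge0.
split; first exact: expR_ge1Dx.
by have /andP[_ h] := inv_bound nS; rewrite subr_ge0 (le_trans h) //; lra.
Qed.

(** Comparing [1 / (2 K) <= alpha <= expR (- a0)] spares a direct estimate of the sum. *)
Lemma sum_inv_le : a0 <= ln (2 * K).
Proof.
have K2 : 0 < 2 * K by rewrite mulr_gt0.
rewrite -ler_expR lnK ?posrE // -[leRHS]invrK -[expR a0]invrK -expRN.
by rewrite lef_pV2 ?posrE ?invr_gt0 ?expR_gt0 // (le_trans alpha_lower) // alpha_le_expR.
Qed.

(** The three errors come from replacing [A] by [a0], from [eps * (1 + A)], and from [beta], made
    relative to [alpha] by [alpha_lower]. *)
Lemma alpha_sub_delta_le (D k : nat) : (1 < D)%N -> ((D ^ 3) ^ k)%:R <= N ->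
  alpha R S - delta_minus R S <=
    (2 * ln (2 * K) / (D ^ 3)%:R
     + (1 + ln (K * N)) * (2 ^+ k / k`!%:R + D%:R^-1) * (1 + 2 * ln (2 * K))
     + 2 * K * (1 + ln (K * N)) ^+ 3 / (D ^ 3)%:R) * alpha R S.
Proof.
have hN := N_ge; have hK := K_gt1.
move=> D1 QN; set Q := (D ^ 3)%N in QN *; set L := ln (2 * K).
pose pi := smooth Q; pose X := Num.truncn (K * N).
set H := 1 + ln (K * N).
have KN1 : 20 <= K * N by nra.
have Q8 : (8 <= Q)%N by rewrite -[8%N]/(2 ^ 3)%N leq_exp2r.
have Q0 : (0 < Q)%N by apply: leq_trans Q8.
have Q8' : 8 <= Q%:R :> R by rewrite (ler_nat R 8 Q).
have H0 : 0 <= H by rewrite addr_ge0 // ln_ge0 //; lra.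
have X0 : (0 < X)%N by rewrite truncn_ge_nat; lra.
have HX : harmonic_sum R X <= H.
  apply: le_trans (harmonic_sum_le R X0) _; rewrite lerD2l ler_ln ?posrE ?ltr0n //.
    by have /andP[] := truncn_itv (le_trans (ler0n R 20) KN1).
  by apply: lt_le_trans KN1.
have SX n : n \in S -> (0 < n <= X)%N.
  move=> nS; rewrite S_gt0 //= truncn_ge_nat; last by lra.
  by have /andP[] := S_in nS.
pose P := (\prod_(n <- S) n)%N.
have P0 := prod_fset_gt0 S_gt0.
have [r rE _] := delta_minus_min R S_gt0.
have dE := density_uncoveredE R S_gt0 r; rewrite rE in dE.
have p_le n : n \in [seq n <- S | ~~ pi.-nat n] -> (n`_pi^')%N%:R^-1 <= Q%:R^-1 :> R.
  rewrite mem_filter => /andP[nsm nS].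
  by rewrite lef_pV2 ?posrE ?ltr0n ?part_gt0 // ler_nat ltnW // rough_part_gt // S_gt0.
have Qinv : Q%:R^-1 <= 1 / 8 :> R by rewrite div1r lef_pV2 ?posrE ?ltr0n.
have := @sieve_by_smooth_part R pi S r _ (fset_uniq S) P0 (fun n => @dvd_prod_fset S n) _.
move=> /(_ (fun n ng => le_trans (p_le n ng) (le_trans Qinv _))) main.
have {main} := main ltac:(lra).
rewrite -ler_pdivlMr ?ltr0n // -dE /=.
set A := \sum_(n <- _) (_ / _); set eps := \sum_(n <- _) _^-1; set beta := (X in _ - X).
move=> main.
have L0 : 0 <= L by rewrite ln_ge0 //; lra.
have a0L : a0 <= L := sum_inv_le.
have a00 : 0 <= a0 by rewrite sumr_ge0.
have AE : A <= a0 + 2 * a0 / Q%:R.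
  have -> : 2 * a0 / Q%:R = a0 * (2 / Q%:R) by rewrite mulrAC mulrC.
  rewrite -{1}[a0]mulr1 -mulrDr /a0 big_distrl /=.
  apply: (@le_trans _ _ (\sum_(n <- [seq n <- S | ~~ pi.-nat n]) n%:R^-1 * (1 + 2 / Q%:R))).
    rewrite /A big_seq [leRHS]big_seq; apply: ler_sum => n ng.
    have n0 : (0 < n)%N by move: ng; rewrite mem_filter => /andP[_ /S_gt0].
    have -> : n%:R^-1 = (n`_pi^')%N%:R^-1 / (n`_pi)%N%:R :> R.
      by rewrite -invfM mulrC -natrM partnC.
    have := p_le n ng; have : 0 <= (n`_pi^')%N%:R^-1 :> R by [].
    set p := (n`_pi^')%N%:R^-1 => p0 pQ.
    rewrite [leRHS]mulrAC ler_wpM2r ?invr_ge0 // mulrDr mulr1 lerD2l expr2.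
    by rewrite mulrCA ler_wpM2l // ler_wpM2l.
  apply: sum_subset_le; rewrite ?filter_uniq ?fset_uniq //.
    by move=> n; rewrite mem_filter => /andP[].
have epsE : eps <= H * (2 ^+ k / k`!%:R + D%:R^-1).
  apply: le_trans (ler_wpM2r _ HX); last by rewrite addr_ge0 ?divr_ge0 ?exprn_ge0.
  rewrite /eps big_filter; apply: smooth_sum_le; rewrite ?fset_uniq //.
  move=> n nS; have /andP[_ ->] := SX n nS; rewrite andbT -(ler_nat R).
  by apply: le_trans QN _; have /andP[/ltW] := S_in nS.
have betaE : beta <= H ^+ 3 / Q%:R.
  apply: (@le_trans _ _ (harmonic_sum R X ^+ 3 / Q%:R)); last first.
    by rewrite ler_wpM2r ?invr_ge0 // lerXn2r ?nnegrE ?harmonic_sum_ge0.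
  apply: gcd_sum_le; rewrite ?filter_uniq ?fset_uniq //.
  by move=> n; rewrite mem_filter => /andP[_ /SX].
have A0 : 0 <= A.
  by rewrite sumr_ge0 // => n _; rewrite mulr_ge0 // addr_ge0 // mulr_ge0 // exprn_ge0.
have eps0 : 0 <= eps by rewrite sumr_ge0.
have al0 := alpha_gt0; have alK := alpha_lower; have ale := alpha_le_expR.
have dm0 := delta_minus_ge0 R S_gt0.
set al := alpha R S in al0 alK ale *; set de := delta_minus R S in main dm0 *.
set x := 2 * a0 / Q%:R in AE.
have x0 : 0 <= x by rewrite divr_ge0 ?mulr_ge0.
have xL : x <= 2 * L / Q%:R by rewrite ler_wpM2r ?invr_ge0 // ler_wpM2l.
(* Hence [A <= 2 * a0 <= 2 * L], which bounds the factor [1 + A] of [y]. *)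
have xa : x <= a0.
  by rewrite ler_pdivrMr ?(lt_le_trans _ Q8') // mulrC ler_wpM2l // (le_trans _ Q8') // ler_nat.
set y := eps * (1 + A) in main.
have y0 : 0 <= y by rewrite mulr_ge0 // addr_ge0.
have yL : y <= H * (2 ^+ k / k`!%:R + D%:R^-1) * (1 + 2 * L).
  rewrite ler_pM ?addr_ge0 //; lra.
have zL : beta <= 2 * K * H ^+ 3 / Q%:R * al.
  apply: le_trans betaE _.
  have -> : 2 * K * H ^+ 3 / Q%:R * al = (al * (2 * K)) * (H ^+ 3 / Q%:R) by ring.
  rewrite ler_peMl ?divr_ge0 ?exprn_ge0 //.
  by rewrite -ler_pdivrMr ?mulr_gt0 // div1r.
move: xL yL zL; set E1 := 2 * L / _; set E2 := H * _ * _; set E3 := 2 * K * _ / _.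
move=> xL yL zL.
(* A total error of at least 1 is harmless because [delta_minus] is nonnegative; otherwise [1 - x]
   and [1 - y] are nonnegative and can be used as factors. *)
have [E_ge1|E_lt1] := leP 1 (E1 + E2 + E3).
  by apply: (@le_trans _ _ al); [lra|rewrite ler_peMl // ltW].
have E30 : 0 <= E3 by rewrite divr_ge0 // !mulr_ge0 ?exprn_ge0 // ltW.
have eA : al * (1 - x) <= expR (- A).
  apply: (@le_trans _ _ (expR (- a0) * expR (- x))); last first.
    by rewrite -expRD ler_expR -opprD lerN2.
  apply: ler_pM; [exact: ltW|lra|by []|exact: expR_ge1Dx].
have : al * (1 - x) * (1 - y) <= expR (- A) * (1 - y) by rewrite ler_wpM2r //; lra.
have := mulr_ge0 (ltW al0) (mulr_ge0 x0 y0).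
have : al * x <= al * E1 by rewrite ler_pM2l.
have : al * y <= al * E2 by rewrite ler_pM2l.
lra.
Qed.
End FixedInterval.

(** * Asymptotics *)

Lemma ln_le_sub1 (R : realType) (x : R) : 0 < x -> ln x <= x - 1.
Proof.
move=> x0; have -> : ln x = ln (1 + (x - 1)) by rewrite addrC subrK.
by apply: le_ln1Dx; lra.
Qed.

(** The exponential series gives [k^k / k! <= e^k]; combine this with [2^k <= e^k]. *)
Lemma two_pow_div_fact_le (R : realType) (k : nat) : (0 < k)%N ->
  2 ^+ k / k`!%:R <= expR (- (k%:R * (ln k%:R - 2))) :> R.
Proof.
case: k => // k _; set n := k.+1.
have n0 : 0 < n%:R :> R by rewrite ltr0n.
have f0 : 0 < n`!%:R :> R by rewrite ltr0n fact_gt0.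
have nf : n%:R ^+ n / n`!%:R <= expR n%:R :> R.
  by apply: le_trans (expR_ge1Dxn k (ltW n0)); rewrite lerDr.
have ne : n%:R ^+ n = expR (n%:R * ln n%:R) :> R.
  by rewrite mulrC expRM_natr lnK.
have e2 : 2 ^+ n <= expR n%:R :> R.
  rewrite -[n%:R]mul1r expRM_natr lerXn2r ?nnegrE ?expR_ge0 //.
  by apply: le_trans (expR_ge1Dx 1); lra.
rewrite ler_pdivrMr //; move: nf; rewrite ler_pdivrMr // ne => nf.
have -> : - (n%:R * (ln n%:R - 2)) = n%:R + n%:R - n%:R * ln n%:R :> R by ring.
rewrite expRD expRN expRD mulrAC ler_pdivlMr ?expR_gt0 //.
rewrite -mulrA; apply: ler_pM => //; exact: expR_ge0.
Qed.

Lemma truncn_half (R : realType) (y : R) : 2 <= y ->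
  [/\ (1 < Num.truncn y)%N, (Num.truncn y)%:R <= y & y / 2 <= (Num.truncn y)%:R].
Proof.
move=> y2; have y0 : 0 <= y by lra.
have /andP[ty yt] := truncn_itv y0; rewrite -natr1 in yt.
split => //; last by lra.
by rewrite truncn_ge_nat.
Qed.

Lemma expR_ge_pow (R : realType) (n : nat) (x : R) : 0 < x ->
  x ^+ n.+1 / (n.+1)`!%:R <= expR x.
Proof. by move=> x0; apply: le_trans (expR_ge1Dxn n (ltW x0)); rewrite lerDr. Qed.

Lemma ln_little_o (R : realType) (t : R) : 0 < t ->
  exists W : R, forall w, W <= w -> 0 < w -> ln w + 2 <= t * w.
Proof.
move=> t0; exists (2 / t * (2 + `|ln (2 / t)|)) => w Ww w0.
have t20 : 0 < 2 / t by rewrite divr_gt0.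
have tw0 : 0 < t * w / 2 by rewrite divr_gt0 // mulr_gt0.
have -> : ln w = ln (t * w / 2) + ln (2 / t).
  by rewrite -lnM ?posrE //; congr ln; field; lra.
have h1 := ln_le_sub1 tw0; have h2 := ler_norm (ln (2 / t)).
have : 2 + `|ln (2 / t)| <= t * w / 2.
  rewrite -(ler_pM2l t20); suff -> : 2 / t * (t * w / 2) = w by [].
  by field; lra.
by move: h1 h2; lra.
Qed.

(** With [L = expR (expR w)] in the role of log N, this makes [expR (- g L w / expR w)] at most
    [L^-4]. It follows from [L >= z^3 / 6] for [z = expR w]. *)
Lemma expR_expR_large (R : realType) (g : R) : 0 < g ->
  exists W : R, forall w, W <= w -> 1 <= w ->
    4 * expR w <= g * (expR (expR w) * w / expR w).
Proof.
move=> g0; exists (24 / g) => w Ww w1.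
have w0 : 0 < w by lra.
have zw : 1 + w <= expR w := expR_ge1Dx w.
have z0 : 0 < expR w := expR_gt0 w.
have := expR_ge_pow 2 z0; have L0 := expR_gt0 (expR w).
move: (expR (expR w)) L0 => L L0; move: (expR w) zw z0 => z zw z0 Lz.
rewrite mulrA ler_pdivlMr //.
have gz : 24 <= g * z.
  by move: Ww; rewrite ler_pdivrMr // mulrC => /le_trans; apply; rewrite ler_pM2l //; lra.
have h1 : g * (z ^+ 3 / 6) <= g * L by rewrite ler_pM2l.
have h2 : g * L <= g * (L * w) by rewrite ler_pM2l // ler_peMr // ltW.
apply: le_trans h2; apply: le_trans h1.
have -> : g * (z ^+ 3 / 6) = g * z * (z * z) / 6 by ring.
have : 24 * (z * z) <= g * z * (z * z) by rewrite ler_wpM2r // mulr_ge0 // ltW.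
by lra.
Qed.

(** Take [k] to be the integer part of [(2 + s) z / w] with [z = expR w]. Then [ln k] is nearly [w],
    so [k (ln k - 2)] is nearly [(2 + s) z]; half of [s] pays for rounding and a quarter for the
    factor [1 - t]. *)
Lemma choose_exponent (R : realType) (s : R) : 0 < s ->
  exists2 u : R, 0 < u & exists W : R, forall w, W <= w -> exists2 k : nat,
    (0 < k)%N & k%:R <= (2 + s) * (expR w / w) /\
    2 ^+ k / k`!%:R <= expR (- ((2 + u) * expR w)).
Proof.
move=> s0; exists (s / 4); first by rewrite divr_gt0.
(* Solves [(2 + s / 2) (1 - t) = 2 + s / 4]. *)
pose t := s / (8 + 2 * s).
have s80 : 0 < 8 + 2 * s by lra.
have t0 : 0 < t by rewrite divr_gt0.
have tE : t * (2 + s / 2) = s / 4 by rewrite /t; field; lra.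
have t1 : t < 1 by rewrite ltr_pdivrMr //; lra.
clearbody t.
have [W2 lnW] := ln_little_o t0.
exists (Num.max 1 (Num.max (4 / s) W2)) => w.
rewrite !ge_max => /and3P[w1 ws wW2].
have w0 : 0 < w by lra.
have lnw := lnW w wW2 w0; clear lnW wW2.
have z0 : 0 < expR w := expR_gt0 w.
have zw : 1 + w <= expR w := expR_ge1Dx w.
have zw2 : w / 2 <= expR w / w.
  by rewrite ler_pdivlMr // mulrAC -expr2; exact: (expR_ge_pow 1).
have lnz : ln (expR w) = w by exact: expRK.
pose k := Num.truncn ((2 + s) * (expR w / w)).
move: (expR w) z0 zw zw2 lnz @k => z z0 zw zw2 lnz k.
have zw0 : 0 < z / w by rewrite divr_gt0.
have zw1 : 1 <= z / w by rewrite ler_pdivlMr // mul1r; lra.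
have [kle kge] : k%:R <= (2 + s) * (z / w) /\ (2 + s) * (z / w) - 1 <= k%:R.
  have /truncn_itv/andP[h1 h2] : 0 <= (2 + s) * (z / w).
    by rewrite mulr_ge0 // ltW //; lra.
  by split => //; rewrite lerBlDr natr1 ltW.
clearbody k.
have szw : 1 <= s / 2 * (z / w).
  have h : s / 2 * (w / 2) <= s / 2 * (z / w) by rewrite ler_pM2l // divr_gt0.
  apply: le_trans h; move: ws; rewrite ler_pdivrMr // mulrC => ws.
  rewrite (_ : s / 2 * (w / 2) = s * w / 4); last by field.
  by rewrite ler_pdivlMr // mul1r.
have kge2 : (2 + s / 2) * (z / w) <= k%:R by move: kge szw; clear; lra.
have s21 : 1 <= 2 + s / 2 by lra.
have s20 : 0 < 2 + s / 2 by lra.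
have k_gt0 : 0 < k%:R :> R by apply: lt_le_trans kge2; rewrite mulr_gt0.
have k0 : (0 < k)%N by rewrite -(ltr0n R).
have lnk : w - ln w <= ln k%:R.
  have -> : w - ln w = ln (z / w) by rewrite ln_div ?posrE // lnz.
  by rewrite ler_ln ?posrE //; apply: le_trans kge2; rewrite ler_peMl // ltW.
exists k => //; split => //.
apply: le_trans (two_pow_div_fact_le R k0) _; rewrite ler_expR lerN2.
have h1 : (1 - t) * w <= ln k%:R - 2 by move: lnk lnw; clear; lra.
have -> : (2 + s / 4) * z = ((2 + s / 2) * (z / w)) * ((1 - t) * w).
  have -> : (2 + s / 2) * (z / w) * ((1 - t) * w) = (2 + s / 2 - t * (2 + s / 2)) * z.
    by field; rewrite gt_eqF.
  by rewrite tE; congr (_ * _); field.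
by apply: ler_pM => //; rewrite mulr_ge0 ?subr_ge0 // ltW.
Qed.

(** [D] is the integer part of [y = expR (L / (3 k))]. Since [y >= 2], also [D >= y / 2], whence the
    factors 2 and 8. *)
Lemma choose_base (R : realType) (L : R) (k : nat) : (0 < k)%N ->
  1 <= L / (3 * k)%:R ->
  exists D : nat, [/\ (1 < D)%N, ((D ^ 3) ^ k)%:R <= expR L,
    D%:R^-1 <= 2 * expR (- (L / k%:R / 3)) &
    (D ^ 3)%:R^-1 <= 8 * expR (- (L / k%:R)) :> R].
Proof.
move=> k0 m1; pose y : R := expR (L / k%:R / 3).
have kE : L / (3 * k)%:R = L / k%:R / 3 by rewrite natrM invfM mulrCA mulrC mulrAC.
have y3 : y ^+ 3 = expR (L / k%:R) by rewrite /y -expRM_natr divfK.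
have k0' : k%:R != 0 :> R by rewrite pnatr_eq0 -lt0n.
have yk : y ^+ (3 * k) = expR L by rewrite exprM y3 -expRM_natr divfK.
have y2 : 2 <= y by rewrite /y -kE; apply: le_trans (expR_ge1Dx _); lra.
have yV : expR (- (L / k%:R / 3)) = y^-1 by rewrite expRN.
have y3V : expR (- (L / k%:R)) = (y ^+ 3)^-1 by rewrite expRN y3.
rewrite yV y3V -yk; clearbody y; clear yV y3V yk y3 kE m1.
have [D1 Dy yD] := truncn_half y2.
set D := Num.truncn y in D1 Dy yD; clearbody D.
have y0 : 0 < y by apply: lt_le_trans y2.
have D0 : 0 < D%:R :> R by rewrite ltr0n ltnW.
have y20 : 0 < y / 2 by rewrite divr_gt0.
exists D; split => //.
- by rewrite -expnM natrX lerXn2r ?nnegrE ?ler0n // ltW.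
- have -> : 2 * y^-1 = (y / 2)^-1.
    by field; rewrite gt_eqF.
  by rewrite lef_pV2 ?posrE.
have -> : 8 * (y ^+ 3)^-1 = ((y / 2) ^+ 3)^-1.
  by field; rewrite gt_eqF.
rewrite natrX lef_pV2 ?posrE ?exprn_gt0 //.
by apply: lerXn2r; rewrite ?nnegrE // ltW.
Qed.

(** Here [F], [d], [q] stand for [2^k / k!], [1 / D], [1 / D^3], and [L] for log N. The three terms
    contribute 32, 30 and 432 times [L^3 G], together below 500. *)
Lemma error_term_le (R : realType) (L K F G d q : R) :
  1 <= L -> 1 < K -> ln K <= L -> 0 <= F -> 0 < G ->
  0 <= d -> d <= 2 * G -> 0 <= q -> K * q <= 8 * G ->
  2 * ln (2 * K) * q + (1 + (ln K + L)) * (F + d) * (1 + 2 * ln (2 * K))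
    + 2 * K * (1 + (ln K + L)) ^+ 3 * q <= 500 * (L ^+ 3 * G) + 15 * (L ^+ 2 * F).
Proof.
move=> L1 K1 lnKL F0 G0 d0 dG q0 KqG.
have K0 : 0 < K by lra.
have L0 : 0 < L by lra.
have qG : q <= 8 * G by apply: le_trans KqG; rewrite ler_peMl // ltW.
have lnK0 : 0 <= ln K by rewrite ln_ge0 // ltW.
have ln2K0 : 0 <= ln (2 * K) by rewrite ln_ge0 //; lra.
have ln2K : ln (2 * K) <= 2 * L.
  rewrite lnM ?posrE //.
  by have := @ln_le_sub1 R 2 ltac:(lra); lra.
move: (ln K) (ln (2 * K)) lnKL lnK0 ln2K0 ln2K => a b aL a0 b0 bL.
have H3 : 1 + (a + L) <= 3 * L by lra.
have H0 : 0 <= 1 + (a + L) by lra.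
have [L3 L23] : L <= L ^+ 3 /\ L ^+ 2 <= L ^+ 3.
  split; last by rewrite ler_weXn2l.
  by rewrite -{1}[L]expr1 ler_weXn2l.
have E1 : 2 * b * q <= 32 * (L ^+ 3 * G).
  apply: (@le_trans _ _ (4 * L * (8 * G))).
    by apply: ler_pM => //; [rewrite mulr_ge0|lra].
  have -> : 4 * L * (8 * G) = 32 * (L * G) by ring.
  by rewrite ler_pM2l // ler_pM2r.
have E2 : (1 + (a + L)) * (F + d) * (1 + 2 * b) <= 15 * (L ^+ 2 * F) + 30 * (L ^+ 3 * G).
  apply: (@le_trans _ _ (3 * L * (F + 2 * G) * (5 * L))).
    have Fd0 : 0 <= F + d by exact: addr_ge0.
    have FdG : F + d <= F + 2 * G by rewrite lerD2l.
    have b0' : 0 <= 1 + 2 * b by lra.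
    have bL' : 1 + 2 * b <= 5 * L by lra.
    have Fd1 : (1 + (a + L)) * (F + d) <= 3 * L * (F + 2 * G) by exact: ler_pM.
    by apply: ler_pM => //; exact: mulr_ge0.
  have -> : 3 * L * (F + 2 * G) * (5 * L) = 15 * (L ^+ 2 * F) + 30 * (L ^+ 2 * G) by ring.
  by rewrite lerD2l ler_pM2l // ler_pM2r.
have E3 : 2 * K * (1 + (a + L)) ^+ 3 * q <= 432 * (L ^+ 3 * G).
  have -> : 2 * K * (1 + (a + L)) ^+ 3 * q = 2 * (1 + (a + L)) ^+ 3 * (K * q) by ring.
  have -> : 432 * (L ^+ 3 * G) = 2 * (3 * L) ^+ 3 * (8 * G) by ring.
  apply: ler_pM => //; [by rewrite mulr_ge0 ?exprn_ge0|by rewrite mulr_ge0 // ltW|].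
  by rewrite ler_pM2l // lerXn2r ?nnegrE // mulr_ge0 // ltW.
have LG0 : 0 <= L ^+ 3 * G by rewrite mulr_ge0 ?exprn_ge0 // ltW.
by move: E1 E2 E3 LG0; clear; lra.
Qed.

(* The parameters w, z and L stand for the threefold, twofold and simple
   logarithm of N. *)
Lemma error_term_small (R : realType) (c e : R) : 0 < c -> c < 1 / 2 -> 0 < e ->
  exists W : R, forall w, W <= w ->
  let z := expR w in let L := expR z in
  forall K : R, 1 < K -> K <= expR (c * (L * w / z)) ->
  exists D k : nat, [/\ (1 < D)%N, ((D ^ 3) ^ k)%:R <= expR L &
    2 * ln (2 * K) / (D ^ 3)%:R
     + (1 + (ln K + L)) * (2 ^+ k / k`!%:R + D%:R^-1) * (1 + 2 * ln (2 * K))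
     + 2 * K * (1 + (ln K + L)) ^+ 3 / (D ^ 3)%:R <= e].
Proof.
move=> c0 c2 e0.
(* The gap [c' - c] will absorb [K], and [c' < 1/2] makes [c'^-1 - 2] positive. *)
have [c' cc' c'2] : exists2 c' : R, c < c' & c' < 1 / 2.
  by exists ((c + 1 / 2) / 2); lra.
have c'0 : 0 < c' by lra.
(* The bound [c' - c] serves for [K / D^3], the bound [c' / 3] for [1 / D]. *)
have [g g0 [g1 g2]] : exists2 g : R, 0 < g & g <= c' - c /\ g <= c' / 3.
  exists (Num.min (c' - c) (c' / 3)); first by rewrite lt_min; apply/andP; split; lra.
  by rewrite !ge_min !lexx orbT.
have s0 : 0 < c'^-1 - 2.
  rewrite subr_gt0 -[ltLHS]invrK ltf_pV2 ?posrE ?invr_gt0 //.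
  by rewrite -div1r.
have [u u0 [W1 kW]] := choose_exponent s0.
have [W2 gW] := expR_expR_large g0.
pose C : R := 500; have C0 : 0 <= C by exact: ler0n.
exists (Num.max 1 (Num.max ((C + 15 / u) / e) (Num.max W1 W2))) => w.
rewrite !ge_max => /and4P[w1 we wW1 wW2] z L K K1 Kle.
have w0 : 0 < w by lra.
have {kW} [k k0 [kle kF]] := kW w wW1.
have {gW wW2} gf := gW w wW2 w1.
rewrite -/z -/L in kle kF gf.
have zw : 1 + w <= z := expR_ge1Dx w.
have Lz : 1 + z <= L := expR_ge1Dx z.
have LN n : L ^+ n = expR (z * n%:R) by rewrite expRM_natr.
have zC : (C + 15 / u) / z <= e.
  rewrite ler_pdivrMr ?expR_gt0 // [leRHS]mulrC -ler_pdivrMr //; apply: le_trans we _.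
  by apply: le_trans zw; rewrite lerDr.
clearbody L; clearbody z.
have z0 : 0 < z by lra.
have L0 : 0 < L by lra.
set f := L * w / z in Kle gf.
have fz : f * z = L * w by rewrite /f divfK // gt_eqF.
have f0 : 0 < f by rewrite divr_gt0 // mulr_gt0.
have fL : f <= L by rewrite ler_pdivrMr // ler_pM2l //; lra.
have k0' : 0 < k%:R :> R by rewrite ltr0n.
(* For [s = c'^-1 - 2], the factor [2 + s] in the bound on [k] is exactly [c'^-1]. *)
have kf : c' * f <= L / k%:R.
  have cf0 : 0 <= c' * f by rewrite mulr_ge0 // ltW.
  rewrite ler_pdivlMr //; have h := ler_wpM2l cf0 kle. apply: (le_trans h).
  rewrite [2 + _]addrC subrK le_eqVlt; apply/orP; left; apply/eqP.
  by rewrite /f; field; rewrite !gt_eqF.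
clearbody f.
have cf : g * f <= (c' - c) * f by rewrite ler_pM2r.
have cf3 : g * f <= c' / 3 * f by rewrite ler_pM2r.
have m1 : 1 <= L / (3 * k)%:R.
  by rewrite natrM invfM mulrCA mulrC; move: kf cf3 gf; clear -z0 w1 zw; lra.
have [D [D1 DL dD qD]] := choose_base k0 m1.
exists D, k; split => //.
set d := D%:R^-1 in dD *; set q := (D ^ 3)%:R^-1 in qD *; set F := 2 ^+ k / k`!%:R in kF *.
set G := expR (- (g * f)).
have G0 : 0 < G := expR_gt0 _.
have lnKL : ln K <= L.
  have : ln K <= ln (expR (c * f)) by rewrite ler_ln ?posrE ?expR_gt0 //; lra.
  rewrite expRK => /le_trans; apply; apply: le_trans fL.
  by rewrite ler_piMl ?(ltW f0) //; lra.
have dG : d <= 2 * G.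
  apply: (le_trans dD); rewrite ler_pM2l // ler_expR lerN2.
  by apply: (le_trans cf3); rewrite mulrAC ler_pM2r.
have KqG : K * q <= 8 * G.
  apply: (@le_trans _ _ (expR (c * f) * (8 * expR (- (L / k%:R))))).
    by apply: ler_pM => //; [lra|rewrite invr_ge0].
  rewrite mulrCA -expRD ler_pM2l // ler_expR.
  by move: kf cf; clear; lra.
have F0 : 0 <= F by rewrite divr_ge0 ?exprn_ge0.
have L1 : 1 <= L by lra.
have d0 : 0 <= d by rewrite invr_ge0.
have q0 : 0 <= q by rewrite invr_ge0.
apply: le_trans (error_term_le L1 K1 lnKL F0 G0 d0 dG q0 KqG) _; rewrite -/C.
have small (v : R) : 0 < v -> expR (- (v * z)) <= (v * z)^-1.
  move=> v0; have vz0 : 0 < v * z by rewrite mulr_gt0.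
  rewrite expRN lef_pV2 ?posrE ?expR_gt0 //; apply: le_trans (expR_ge1Dx _).
  by rewrite lerDr.
(* By [gf], [G <= expR (- 4 z)], against [L ^ 3 = expR (3 z)]. *)
have LG : L ^+ 3 * G <= z^-1.
  rewrite -[z in z^-1]mul1r; apply: le_trans (small 1 _) => //.
  by rewrite LN -expRD ler_expR; move: gf; clear; lra.
have LF : L ^+ 2 * F <= (u * z)^-1.
  apply: le_trans (small u u0).
  apply: (@le_trans _ _ (L ^+ 2 * expR (- ((2 + u) * z)))).
    by rewrite ler_pM2l // exprn_gt0.
  by rewrite LN -expRD ler_expR le_eqVlt; apply/orP; left; apply/eqP; ring.
apply: le_trans zC.
have -> : (C + 15 / u) / z = C * z^-1 + 15 * (u * z)^-1.
  by field; rewrite !gt_eqF.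
by apply: lerD; rewrite ler_wpM2l.
Qed.

(** * Uniformity in [K] and [S], and the error function *)

Definition admissible (R : realType) (c N K : R) (S : {fset nat}) :=
  [/\ 1 < K, K <= expR (c * (ln N * ln (ln (ln N)) / ln (ln N))) &
      forall n : nat, n \in S -> N < n%:R <= K * N].

Lemma delta_minus_dist (R : realType) (N K : R) (S : {fset nat}) :
  20 <= N -> (forall n : nat, n \in S -> N < n%:R <= K * N) ->
  `|delta_minus R S - alpha R S| = alpha R S - delta_minus R S.
Proof.
move=> N20 SN; rewrite distrC ger0_norm // subr_ge0 delta_minus_le_alpha // => n /SN/andP[Nn _].
by rewrite -(ltr0n R) (lt_trans _ Nn) // (lt_le_trans _ N20).
Qed.

(** The threshold for the triple logarithm becomes one for [N] after three exponentials,
    independently of [K] and [S]. *)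
Lemma uniform_error (R : realType) (c e : R) : 0 < c -> c < 1 / 2 -> 0 < e ->
  exists N0 : R, forall N K S, N0 <= N -> 20 <= N -> admissible c N K S ->
    `|delta_minus R S - alpha R S| <= e * alpha R S.
Proof.
move=> c0 c2 e0; have [W HW] := error_term_small c0 c2 e0.
exists (expR (expR (expR W))) => N K S NW N20 [K1 Kle SN].
have N0 : 0 < N by apply: lt_le_trans NW; exact: expR_gt0.
have lnN : expR (expR W) <= ln N by rewrite -ler_expR lnK.
have lnN0 : 0 < ln N by apply: lt_le_trans lnN; exact: expR_gt0.
have llN : expR W <= ln (ln N) by rewrite -ler_expR lnK.
have llN0 : 0 < ln (ln N) by apply: lt_le_trans llN; exact: expR_gt0.
have lllN : W <= ln (ln (ln N)) by rewrite -ler_expR lnK.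
have /= := HW _ lllN; rewrite !lnK ?posrE // => /(_ K K1 Kle) [D [k [D1 DN Ee]]].
rewrite (delta_minus_dist N20 SN).
apply: le_trans (alpha_sub_delta_le N20 K1 SN D1 DN) _.
rewrite ler_wpM2r ?(ltW (alpha_gt0 N20 SN)) //.
by rewrite (@lnM R K N) ?posrE // (lt_trans ltr01).
Qed.

Theorem theoremB (R : realType) (c : R) (c_gt0 : 0 < c) (c_lt : c < 1 / 2) :
  exists eta : R -> R,
    [/\ forall N : R, 20 <= N -> 0 <= eta N,
        eta N @[N --> +oo] --> (0 : R) &
        forall (N K : R) (S : {fset nat}),
          20 <= N ->
          1 < K ->
          K <= expR (c * (ln N * ln (ln (ln N)) / ln (ln N))) ->
          (forall n : nat, n \in S -> N < n%:R <= K * N) ->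
          `|delta_minus R S - alpha R S| <= eta N * alpha R S].
Proof.
(* [eta N] is the supremum of all relative errors at [N]; adjoining 0 makes the set nonempty and the
   supremum nonnegative. *)
pose E (N : R) := [set x : R | x = 0 \/ exists K S,
  admissible c N K S /\ x = `|delta_minus R S - alpha R S| / alpha R S].
pose eta N := sup (E N).
have E0 N : E N 0 by left.
(* From [0 <= delta_minus <= alpha]; boundedness ensures that [sup] is a true supremum and not a
   default value. *)
have E_le1 N : 20 <= N -> ubound (E N) 1.
  move=> N20 x [->//|[K [S [[K1 _ SN] ->]]]].
  rewrite ler_pdivrMr ?(alpha_gt0 N20 SN) // mul1r (delta_minus_dist N20 SN).
  rewrite lerBlDr lerDl delta_minus_ge0 // => n /SN/andP[Nn _].
  by rewrite -(ltr0n R) (lt_trans _ Nn) // (lt_le_trans _ N20).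
have eta_ub N x : 20 <= N -> E N x -> x <= eta N.
  by move=> N20; apply: ub_le_sup; exists 1; exact: E_le1.
exists eta; split.
- by move=> N N20; exact: eta_ub.
- apply/cvgrPdist_le => e e0.
  have [N0 HN0] := uniform_error c_gt0 c_lt e0.
  near=> N.
  have N20 : 20 <= N by near: N; apply: nbhs_pinfty_ge; exact: num_real.
  have N0N : N0 <= N by near: N; apply: nbhs_pinfty_ge; exact: num_real.
  rewrite sub0r normrN ger0_norm; last exact: eta_ub.
  apply: ge_sup; first by exists 0.
  move=> x [->|[K [S [adm ->]]]]; first exact: ltW.
  have [_ _ SN] := adm.
  by rewrite ler_pdivrMr ?(alpha_gt0 N20 SN) //; exact: HN0 adm.
- move=> N K S N20 K1 Kle SN.
  rewrite -ler_pdivrMr ?(alpha_gt0 N20 SN) //; apply: eta_ub => //.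
  by right; exists K, S.
Unshelve. all: by end_near.
Qed.
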